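(* Let $(\mathcal{D},\times)$ be an associative and commutative semigroup and $(A,\Phi)$ be a finite-dimensional dual $\ell$CEDS. Consider the symmetric algebra $S(\mathfrak{g}_{A,\mathcal{D}})$ generated by $\mathfrak{g}_{A,\mathcal{D}}$, with its usual product $m$. For any $A$-typed and $\mathcal{D}$-decorated forest $F$, put $$\delta(F)=\sum_{I\subseteq E(F)}F_{\mid I}\otimes_\Phi F_{/I}.$$ Then $(S(\mathfrak{g}_{A,\mathcal{D}}),m,\delta)$ is a bialgebra.
   Context: $\mathbb{K}$ is a field of characteristic zero and all vector spaces are over $\mathbb{K}$; $\tau$ is the flip of $A\otimes A$. A dual $\ell$CEDS is a pair $(A,\Phi)$ with $A$ a vector space and $\Phi:A\otimes A\to A\otimes A$ linear such that $(\mathrm{Id}\otimes\Phi)\circ(\Phi\otimes\mathrm{Id})\circ(\mathrm{Id}\otimes\Phi)=(\Phi\otimes\mathrm{Id})\circ(\mathrm{Id}\otimes\tau)\circ(\Phi\otimes\mathrm{Id})$ and $(\Phi\otimes\mathrm{Id})\circ(\tau\otimes\mathrm{Id})\circ(\mathrm{Id}\otimes\tau)\circ(\mathrm{Id}\otimes\Phi)=(\mathrm{Id}\otimes\tau)\circ(\mathrm{Id}\otimes\Phi)\circ(\Phi\otimes\mathrm{Id})\circ(\tau\otimes\mathrm{Id})$. An $A$-typed and $\mathcal{D}$-decorated rooted tree is a (non-planar) rooted tree whose vertices are decorated by elements of $\mathcal{D}$ and whose edges are typed by elements of $A$; $\mathfrak{g}_{A,\mathcal{D}}$ is the vector space generated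 by them, trees being linear in the type of each edge. A forest is a (commutative) product of such trees, i.e. a monomial of $S(\mathfrak{g}_{A,\mathcal{D}})$; $E(F)$ is the set of edges of $F$. For $I\subseteq E(F)$: $F_{\mid I}$ is the forest obtained from $F$ by deleting all the edges not in $I$ (same vertices and decorations, edges $I$). $F_{/I}$ is the forest obtained by contracting all the edges in $I$ (its edges are $E(F)\setminus I$); each of its vertices $v$ is the contraction of a subtree $T_v$ of $F$, and is decorated by the product in $(\mathcal{D},\times)$ of the decorations of the vertices of $T_v$. $F_{\mid I}\otimes_\Phi F_{/I}$ is the sum of tensors of $A$-typed and $\mathcal{D}$-decorated forests obtained from $F_{\mid I}\otimes F_{/I}$ by modifying the types as follows. For each edge $e\notin I$ (these edges being treated successively; the result does not depend on the order), let $e_1,\ldots,e_k$ be the edges belonging to $I$ in the path of $F$ from the root of the tree containing $e$ to the first extremity of $e$ (the one closest to the root), listed starting from the root; let $a$ be the (current) type of $e$ and $a_i$ the (current) type of $e_i$. Compute $$\sum_{i=1}^p a'_i\otimes a'_{1,i}\otimes\ldots\otimes a'_{k,i}=\left(\Phi\otimes\mathrm{Id}^{\otimes(k-1)}\right)\circ\left(\mathrm{Id}\otimes\Phi\otimes\mathrm{Id}^{\otimes(k-2)}\right)\circ\ldots\circ\left(\mathrm{Id}^{\otimes(k-1)}\otimes\Phi\right)(a_1\otimes\ldots\otimes a_k\otimes a)$$ and take the sum over $1\leq i\leq p$ of the tensors obtained by typing $e$ by $a'_i$ and $e_j$ by $a'_{j,i}$ for each $j$. (If $k=0$, nothing is 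changed.)
   Formalization: The e_1,…,e_k for an edge e not in I are only the I-edges on the path to e from the root of the subtree T_v containing e's first extremity (those after the last edge not in I), not all I-edges above e in F; with all of them, delta is not coassociative (ladder with three edges). *)

(* Defs.v *)
From HB Require Import structures.
From mathcomp Require Import all_boot all_order all_algebra.
From mathcomp Require Import finmap.
From mathcomp.multinomials Require Import monalg.

Set Implicit Arguments.
Unset Strict Implicit.
Unset Printing Implicit Defensive.

Import GRing.Theory.
Local Open Scope ring_scope.
Local Open Scope quotient_scope.

(** * Rooted trees, vertices decorated by [D], edges labelled by [X] *)

(* [Node d s] has a root decorated by [d]; each pair [(x, t)] of [s] is an edge
   labelled by [x] from that root to the root of [t].  These trees are planar:
   the non-planar ones are the quotient [rtree] below. *)
Inductive tree (D X : Type) := Node of D & seq (X * tree D X).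

Section TreeInduction.
Variables (D X : Type) (P : tree D X -> Prop).
Hypothesis PN :
  forall d s, foldr (fun x Q => P x.2 /\ Q) True s -> P (Node d s).

Fixpoint tree_nested_ind t : P t :=
  let: Node d s := t in
  PN d ((fix loop s : foldr (fun x Q => P x.2 /\ Q) True s :=
    match s with
    | [::] => I
    | (x, u) :: s' => conj (tree_nested_ind u) (loop s')
    end) s).
End TreeInduction.

Section TreeChoice.
Variables D X : Type.

Fixpoint tree_encode (t : tree D X) : GenTree.tree (D + X) :=
  let: Node d s := t in
  GenTree.Node 0 (GenTree.Leaf (inl d) ::
    [seq GenTree.Node 0 [:: GenTree.Leaf (inr x.1); tree_encode x.2] | x <- s]).

Fixpoint tree_decode (g : GenTree.tree (D + X)) : option (tree D X) :=
  if g is GenTree.Node _ (GenTree.Leaf (inl d) :: s) then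
    Some (Node d (pmap (fun h =>
      if h is GenTree.Node _ [:: GenTree.Leaf (inr x); u] then
        omap (pair x) (tree_decode u) else None) s))
  else None.

Lemma tree_encodeK : pcancel tree_encode tree_decode.
Proof.
elim/tree_nested_ind => d s IH /=; congr (Some (Node d _)).
by elim: s IH => //= -[x t] s IHs /= [-> /IHs ->].
Qed.
End TreeChoice.

HB.instance Definition _ (D X : eqType) :=
  Equality.copy (tree D X) (pcan_type (@tree_encodeK D X)).
HB.instance Definition _ (D X : choiceType) :=
  Choice.copy (tree D X) (pcan_type (@tree_encodeK D X)).

(* Isomorphism of decorated and labelled rooted trees, the order of the
   children being irrelevant. *)
Fixpoint tree_iso (D X : eqType) (t t' : tree D X) : bool :=
  let: Node d s := t in let: Node d' s' := t' in
  (d == d') &&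
  has (all2 (fun x y => (x.1 == y.1) && tree_iso x.2 y.2) s) (permutations s').

Section TreeIsoEquivalence.
Variables D X : eqType.
Implicit Types (t : tree D X) (s : seq (X * tree D X)).

Lemma tree_mem_ind (P : tree D X -> Prop) :
  (forall d s, {in s, forall x, P x.2} -> P (Node d s)) -> forall t, P t.
Proof.
move=> PN; elim/tree_nested_ind => d s IH; apply: PN.
elim: s IH => //= y s IHs [Py /IHs {}IHs] x.
by rewrite inE => /predU1P[->|/IHs].
Qed.

Let ciso (x y : X * tree D X) := (x.1 == y.1) && tree_iso x.2 y.2.

Lemma tree_isoP d s d' s' :
  reflect (d = d' /\ exists2 u, perm_eq u s' & all2 ciso s u)
          (tree_iso (Node d s) (Node d' s')).
Proof.
apply: (iffP andP) => -[/eqP dd' H]; split=> //.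
  by have /hasP[u] := H; rewrite mem_permutations => us ?; exists u.
by have [u us su] := H; apply/hasP; exists u; rewrite // mem_permutations.
Qed.

Lemma all2_perm (T : eqType) (r : T -> T -> bool) (s u v : seq T) :
  all2 r s u -> perm_eq u v -> exists2 w, perm_eq w s & all2 r w v.
Proof.
case: s => [|x0 s0]; first by case: u => // _; rewrite perm_sym => /perm_nilP->; exists [::].
set s := x0 :: s0; rewrite all2E => /andP[/eqP suz /allP ru] uv.
rewrite perm_sym in uv; have /(perm_iotaP x0)[Is Isp ->] := uv.
exists [seq nth x0 s i | i <- Is].
  by apply/(perm_iotaP x0); exists Is; rewrite // suz.
rewrite all2E !size_map eqxx zip_map all_map /=; apply/allP => i.
rewrite (perm_mem Isp) mem_iota add0n => /= iu.
by apply: (ru (_, _)); rewrite -nth_zip // mem_nth // size_zip suz minnn.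
Qed.

Lemma tree_iso_refl : reflexive (@tree_iso D X).
Proof.
elim/tree_mem_ind => d s IH; apply/tree_isoP; split=> //; exists s => //.
elim: s IH => //= x s IHs IH; rewrite {1}/ciso eqxx IH ?mem_head //=.
by apply: IHs => y ys; apply: IH; rewrite inE ys orbT.
Qed.

Lemma all2_sub (T : eqType) (r r' : T -> T -> bool) (s u : seq T) :
  {in s, forall x y, r x y -> r' y x} -> all2 r s u -> all2 r' u s.
Proof.
elim: s u => [|x s IHs] [|y u] //= IH /andP[rxy rsu].
rewrite IH ?mem_head //=; apply: IHs rsu => z zs w; apply: IH.
by rewrite inE zs orbT.
Qed.

Lemma tree_iso_imp_sym t t' : tree_iso t t' -> tree_iso t' t.
Proof.
elim/tree_mem_ind: t t' => d s IH [d' s'] /tree_isoP[-> [u us' su]].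
apply/tree_isoP; split=> //; have [w ws ws'] := all2_perm su us'.
exists w => //; apply: all2_sub ws' => x xw y /andP[/eqP xy1 xy2].
by rewrite /ciso xy1 eqxx IH // -(perm_mem ws).
Qed.

Lemma tree_iso_sym : symmetric (@tree_iso D X).
Proof. by move=> t t'; apply/idP/idP; apply: tree_iso_imp_sym. Qed.

Lemma tree_iso_trans : transitive (@tree_iso D X).
Proof.
move=> t2 t1; elim/tree_mem_ind: t1 t2 => d s IH [d2 s2] [d3 s3].
move=> /tree_isoP[-> [u us2 su]] /tree_isoP[-> [v vs3 sv]].
apply/tree_isoP; split=> //.
have vs2 : all2 (fun x y => ciso y x) v s2 by apply: all2_sub sv.
have [w wv wu] : exists2 w, perm_eq w v & all2 (fun x y => ciso y x) w u.
  by apply: all2_perm vs2 _; rewrite perm_sym.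
exists w; first exact: perm_trans wv vs3.
elim: s u w IH su wu {us2 wv} => [|x s IHs] [|y u] [|z w] //= IH.
move=> /andP[/andP[/eqP xy1 xy2] su] /andP[/andP[/eqP yz1 yz2] wu].
rewrite /ciso xy1 yz1 eqxx (IH _ (mem_head _ _) _ _ xy2 yz2) /=.
by apply: IHs su wu => a as_ ?; apply: IH; rewrite inE as_ orbT.
Qed.

Canonical tree_iso_equiv :=
  EquivRel (@tree_iso D X) tree_iso_refl tree_iso_sym tree_iso_trans.
End TreeIsoEquivalence.

(* Non-planar rooted trees. *)
Definition rtree (D X : choiceType) := {eq_quot @tree_iso_equiv D X}.
HB.instance Definition _ (D X : choiceType) := Choice.on (rtree D X).

(** * Forests and operations on their edges *)

Section Forests.

Fixpoint map_tree (D X Y : Type) (f : X -> Y) (t : tree D X) : tree D Y :=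
  let: Node d s := t in Node d [seq (f x.1, map_tree f x.2) | x <- s].

Fixpoint tree_edges (D X : Type) (t : tree D X) : seq X :=
  let: Node _ s := t in flatten [seq x.1 :: tree_edges x.2 | x <- s].

Definition edges (D X : Type) (F : seq (tree D X)) : seq X :=
  flatten (map (@tree_edges D X) F).

(* The commutative monomial, in the variables [rtree D X], of a forest. *)
Definition monomial (D X : choiceType) (F : seq (tree D X)) :
    {cmonom (rtree D X)} :=
  \big[mmul/mone]_(t <- F) ucm (\pi_(rtree D X) t).

Variables (D : semigroupType) (E : finType).
Implicit Types (I : {set E}) (t : tree D E) (F : seq (tree D E)).

(* The pair of the component of the root and the other components of the forest
   obtained by deleting the edges which are not in [I]. *)
Fixpoint restrict_tree I t : tree D E * seq (tree D E) :=
  let: Node d s := t in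
  let rs := [seq (x.1, restrict_tree I x.2) | x <- s] in
  (Node d [seq (r.1, r.2.1) | r <- rs & r.1 \in I],
   flatten [seq if r.1 \in I then r.2.2 else r.2.1 :: r.2.2 | r <- rs]).

Definition restrict I F : seq (tree D E) :=
  flatten [seq (restrict_tree I t).1 :: (restrict_tree I t).2 | t <- F].

Definition root_dec (t : tree D E) : D := let: Node d _ := t in d.
Definition children (t : tree D E) : seq (E * tree D E) :=
  let: Node _ s := t in s.

Fixpoint contract_tree I t : tree D E :=
  let: Node d s := t in
  let cs := [seq (x.1, contract_tree I x.2) | x <- s] in
  Node (foldl (fun p q : D => p * q)%g d [seq root_dec c.2 | c <- cs & c.1 \in I])
       (flatten [seq if c.1 \in I then children c.2 else [:: c] | c <- cs]).

Definition contract I F : seq (tree D E) := map (contract_tree I) F.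

(* The edges strictly above [e], i.e. on the path from the root to the extremity
   of [e] closest to it, starting from the root ([e] occurs at most once). *)
Fixpoint tree_above (e : E) t : seq E :=
  let: Node _ s := t in
  flatten [seq if e \in tree_edges x.2 then x.1 :: tree_above e x.2 else [::]
          | x <- s].

Definition above F (e : E) : seq E := flatten (map (tree_above e) F).

(* The edges e_1, .., e_k acted on by an edge [e] which is not in [I].  The
   extremity of [e] closest to the root lies in a tree T_v of [restrict I F],
   contracted to a vertex v of [contract I F]; the e_i form the path of [F] from
   the root of T_v to that extremity, that is, they are the edges above [e] which
   come after the last one not in [I].  The edges of [I] above T_v are not
   included: with them, delta is not coassociative, for instance on the ladder
   with three edges when dim A > 1 and Phi (a (x) b) = s(a) s(b) c (x) c with a
   linear form s such that s(c) = 1. *)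
Definition path_above I F (e : E) : seq E :=
  foldl (fun p e' => if e' \in I then rcons p e' else [::]) [::] (above F e).

End Forests.

(** * Tensors over a finite-dimensional space, dual l-CEDS *)

Section Tensors.
Variables (K : fieldType) (A : vectType K).

(* Indices of the basis [vbasis {:A}] of [A].  Tensors are given by their
   coordinates in the induced bases. *)
Definition bidx := 'I_(\dim {:A}).

(* A (x) A : the entry (i, j) is the coefficient of b_i (x) b_j; the flip is the
   transposition. *)
Definition tensor2 := 'M[K]_(\dim {:A}).
HB.instance Definition _ := GRing.Lmodule.on tensor2.

(* The tensor power of [A] whose factors are indexed by [E]. *)
Definition tpow (E : finType) := {ffun {ffun E -> bidx} -> K}.

Definition pure (E : finType) (a : E -> A) : tpow E :=
  [ffun b : {ffun E -> bidx} =>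
     \prod_(e : E) coord (vbasis {:A}) (b e) (a e)].

Definition upd2 (E : finType) (b : {ffun E -> bidx}) (x y : E) (i j : bidx) :
    {ffun E -> bidx} :=
  [ffun z => if z == x then i else if z == y then j else b z].

(* The map f : A (x) A -> A (x) A acting on the factors x and y (in this order)
   and the identity acting on the other ones, for x != y. *)
Definition act2 (E : finType) (f : tensor2 -> tensor2) (x y : E) (t : tpow E) :
    tpow E :=
  [ffun b : {ffun E -> bidx} =>
     f (\matrix_(i, j) t (upd2 b x y i j)) (b x) (b y)].

Definition flip (M : tensor2) : tensor2 := M^T.

Definition dual_lCEDS (Phi : {linear tensor2 -> tensor2}) : Prop :=
  let f12 f := @act2 'I_3 f (inord 0) (inord 1) in
  let f23 f := @act2 'I_3 f (inord 1) (inord 2) in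
  (forall t, f23 Phi (f12 Phi (f23 Phi t)) = f12 Phi (f23 flip (f12 Phi t))) /\
  (forall t, f12 Phi (f12 flip (f23 flip (f23 Phi t))) =
             f23 flip (f23 Phi (f12 Phi (f12 flip t)))).

(* The modification of the types caused by the edges not in [I], treated in the
   order of [enum].  In Phi (a_j (x) a) = sum a' (x) a'_j the first factor is
   the new type of [e] and the second one the new type of e_j, hence the flip;
   [foldr] applies the last edge of the path first. *)
Definition twist_edge (E : finType) (Phi : tensor2 -> tensor2) (e : E)
    (p : seq E) (t : tpow E) : tpow E :=
  foldr (fun e' => act2 (flip \o Phi) e' e) t p.

Definition twist (D : semigroupType) (E : finType) (Phi : tensor2 -> tensor2)
    (I : {set E}) (F : seq (tree D E)) (t : tpow E) : tpow E :=
  foldl (fun u e => twist_edge Phi e (path_above I F e) u)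
        t (enum (~: I)).

End Tensors.

(** * Bialgebras on monoid algebras *)

(* {malg K[M]} (x) {malg K[N]} is {malg K[M * N]}, with the product monoid. *)
Section MonomialPair.
Variables M N : monomType.
Implicit Types x y : M * N.

Let one : M * N := (mone, mone).
Let mul x y : M * N := (mmul x.1 y.1, mmul x.2 y.2).

Let mulA : associative mul.
Proof. by move=> x y z; rewrite /mul /= !mulmA. Qed.
Let mul1 : left_id one mul.
Proof. by case=> x y; rewrite /mul /= !mul1m. Qed.
Let mulr1 : right_id one mul.
Proof. by case=> x y; rewrite /mul /= !mulm1. Qed.
Let mul_unit x y : mul x y = one -> x = one /\ y = one.
Proof.
by case: x y => [x1 x2] [y1 y2] [/= /unitm[-> ->] /unitm[-> ->]].
Qed.

HB.instance Definition _ :=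
  Choice_isMonomialDef.Build (M * N)%type mulA mul1 mulr1 mul_unit.
End MonomialPair.

Section Bialgebra.
Variable K : fieldType.

(* The linear extension of a map defined on the basis [M]. *)
Definition linext (M : choiceType) (V : lmodType K) (h : M -> V)
    (u : {malg K[M]}) : V :=
  \sum_(m <- msupp u) u@_m *: h m.

Definition tens (M N : monomType) (u : {malg K[M]}) (v : {malg K[N]}) :
    {malg K[prod M N]} :=
  linext (fun m => linext (fun n => << (m, n) >>) v) u.

Definition tens_map (M N M' N' : monomType) (f : {malg K[M]} -> {malg K[M']})
    (g : {malg K[N]} -> {malg K[N']}) :
    {malg K[prod M N]} -> {malg K[prod M' N']} :=
  linext (fun p : M * N => tens (f << p.1 >>) (g << p.2 >>)).

Definition tens_assoc (M : monomType) :
    {malg K[prod (prod M M) M]} -> {malg K[prod M (prod M M)]} :=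
  linext (fun p : M * M * M => << (p.1.1, (p.1.2, p.2)) >>).

Definition bialgebra (M : monomType)
    (delta : {linear {malg K[M]} -> {malg K[prod M M]}}) : Prop :=
  [/\ monoid_morphism delta,
      forall u, tens_assoc (tens_map delta id (delta u)) =
                tens_map id delta (delta u)
    & exists eps : {linear {malg K[M]} -> K^o},
      [/\ monoid_morphism (eps : {malg K[M]} -> K),
          forall u,
            linext (fun p : M * M => eps << p.1 >> *: << p.2 >>) (delta u) = u
        & forall u,
            linext (fun p : M * M => eps << p.2 >> *: << p.1 >>) (delta u) = u]].

End Bialgebra.

(** * The symmetric algebra on typed trees and its coproduct *)

Section Coproduct.
Variables (K : fieldType) (A : vectType K) (D : semigroupType).

(* Trees are linear in the type of each edge, so those typed by elements of the
   basis of [A] form a basis of g_{A,D}, and the monomials in them a basis of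
   S(g_{A,D}). *)
Definition forest_monom : monomType := {cmonom (rtree D (bidx A))}.
Definition Sg := {malg K[forest_monom]}.
Definition Sg2 := {malg K[prod forest_monom forest_monom]}.
HB.instance Definition _ := GRing.Lalgebra.on Sg.
HB.instance Definition _ := GRing.Lalgebra.on Sg2.

Section Typing.
Variable E : finType.
Implicit Types (F G H : seq (tree D E)) (t : tpow A E).

(* The forest [F], whose edge [e] has type [a e]. *)
Definition forest F (a : E -> A) : Sg :=
  \sum_(b : {ffun E -> bidx A}) pure a b *: << monomial (map (map_tree b) F) >>.

(* The tensor of forests G (x) H, whose edges are typed by [t]. *)
Definition forest2 G H t : Sg2 :=
  \sum_(b : {ffun E -> bidx A})
    t b *: << (monomial (map (map_tree b) G) : forest_monom,
               monomial (map (map_tree b) H) : forest_monom) >>.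
End Typing.

(* An A-typed forest is a forest whose edges are bijectively labelled by a
   finite set [E], together with [a : E -> A]. *)
Definition coproduct_formula
    (Phi : {linear tensor2 A -> tensor2 A}) (delta : Sg -> Sg2) : Prop :=
  forall (E : finType) (F : seq (tree D E)), perm_eq (edges F) (enum E) ->
  forall a : E -> A,
    delta (forest F a) =
    \sum_(I : {set E})
      forest2 (restrict I F) (contract I F) (twist Phi I F (pure a)).

End Coproduct.

(* Main.v *)
(* Write Psi_(x,y) for the map flip o Phi acting on the tensor factors x and y.
   The axioms of a dual l-CEDS say that, for distinct x, y, z,
     Psi_(x,y) Psi_(x,z) Psi_(y,z) = Psi_(y,z) Psi_(x,y)
   and that Psi_(x,y) and Psi_(x,z) commute; moreover Psi's acting on disjoint
   pairs of factors commute.  An edge e outside I twists the types by the product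
   T_e of the Psi_(x,e), x running over the edges of I that act on e, and the T_e
   commute with each other.

   Both sides of coassociativity are sums over pairs of disjoint sets J, L of
   edges, with J kept at the lower level and L at the middle one, of the same
   three forests, so that only the twists have to be compared.  Let S be the
   twist by J of the edges of L.  For an edge e outside J and L one has
     S T_e = U_e V_e S,
   where T_e involves the edges of J and L directly above e, U_e those in L only,
   and V_e those of J after the last edge in L: an induction along the path to e applies
   the first axiom once at each edge f in L, in the form
     S_f (prod_x Psi_(x,e)) Psi_(f,e) = Psi_(f,e) S_f,
   x running over the edges of J directly above f, and S_f = prod_x Psi_(x,f).

   On the basis, delta is defined by labelling the edges of a monomial.  Two
   labellings differ by an isomorphism of forests and an injection of the sets of
   labels, and the formula is invariant under both; injections that are not
   surjective give delta on the forests F_|I and F_/I, labelled by all the edges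
   of F.  Multiplicativity is obtained with a disjoint union of sets of labels. *)

From HB Require Import structures.
Require Import Defs.
From mathcomp Require Import all_boot all_order all_algebra.
From mathcomp Require Import fingroup perm finmap.
From mathcomp.multinomials Require Import monalg.
Set Implicit Arguments.
Unset Strict Implicit.
Unset Printing Implicit Defensive.
Import GRing.Theory.
Local Open Scope ring_scope.
Local Open Scope quotient_scope.

(** * Lists *)

Section Seq.

(** Turns an equality of multisets of images into a reordering of the sources followed by an
    entrywise equality. This is how isomorphisms of children and of forests are taken apart
    below. *)
Lemma perm_map_lift (T1 T2 T3 : eqType) (p : T1 -> T3) (q : T2 -> T3) s1 s2 :
  perm_eq (map p s1) (map q s2) -> exists2 s, perm_eq s1 s & map p s = map q s2.
Proof.
elim: s2 s1 => [|y s2 IH] s1.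
  by move=> /perm_nilP /eqP; rewrite -size_eq0 size_map size_eq0 => /eqP->; exists [::].
move=> Hp; have : q y \in map p s1 by rewrite (perm_mem Hp) mem_head.
case/mapP => x xs qp; have xr := perm_to_rem xs.
have /IH[s ps ms] : perm_eq (map p (rem x s1)) (map q s2).
  rewrite -(perm_cons (q y)) {1}qp -map_cons.
  by apply: perm_trans Hp; rewrite perm_sym perm_map.
exists (x :: s); last by rewrite /= ms qp.
by apply: perm_trans xr _; rewrite perm_cons.
Qed.

(** Commutation is asked only between entries of the list, because the twists by two edges commute
    only when neither edge acts on the other. *)
Lemma foldl_perm (T1 : Type) (T2 : eqType) (f : T1 -> T2 -> T1) s1 s2 z :
  {in s1 &, forall x y z, f (f z x) y = f (f z y) x} ->
  perm_eq s1 s2 -> foldl f z s1 = foldl f z s2.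
Proof.
elim: s1 s2 z => [|x s1 IH] s2 z fC; first by rewrite perm_sym => /perm_nilP->.
move=> H; have xs2 : x \in s2 by rewrite -(perm_mem H) mem_head.
case/splitPr: xs2 H => u v H.
rewrite /= (IH (u ++ v)); last 2 first.
- by move=> y y' ys ys'; apply: fC; rewrite inE ?ys ?ys' orbT.
- by rewrite -(perm_cons x) (perm_trans H) // -cat1s perm_catCA.
rewrite !foldl_cat /=; congr (foldl f _ v).
(* It remains to move [x] past the entries of [u] that precede it in [s2]. *)
have {H} : {subset u <= x :: s1} by move=> y yu; rewrite (perm_mem H) mem_cat yu.
elim: u z => //= y u IHu z yu; rewrite (fC x y) ?mem_head ?IHu //.
  by move=> y' y'u; apply: yu; rewrite inE y'u orbT.
by apply: yu; rewrite mem_head.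
Qed.

(* A list all of whose blocks but one are empty does not depend on the order of
   the blocks: this makes the ancestors of an edge independent of the planar
   structure. *)
Lemma flatten_map_eq (T X : eqType) (Y : Type) (g : T -> seq X) (f : T -> seq Y)
    s x e : uniq (flatten (map g s)) -> x \in s -> e \in g x ->
  (forall y, e \notin g y -> f y = [::]) -> flatten (map f s) = f x.
Proof.
move=> + + ex f0; elim: s => //= y s IH; rewrite cat_uniq inE => /and3P[_ ny us].
have nex z : e \notin flatten (map g z) -> flatten (map f z) = [::].
  elim: z => [|z zs IHz] //=; rewrite mem_cat negb_or => /andP[/f0-> /IHz->//].
case/predU1P => [xy|xs]; first subst y.
  rewrite (nex s) ?cats0 //; apply: contra ny => es.
  apply/hasP; exists e => //.
rewrite (IH us xs) f0 //; apply: contra ny => ey; apply/hasP; exists e => //.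
by apply/flatten_mapP; exists x.
Qed.

Lemma flatten_map_nil (T : eqType) Y (f : T -> seq Y) s :
  {in s, forall x, f x = [::]} -> flatten (map f s) = [::].
Proof.
elim: s => //= x s IH H; rewrite H ?mem_head //= IH // => y ys.
by rewrite H // inE ys orbT.
Qed.

Lemma map_flatten_map (T Y Z : Type) (f : Y -> Z) (g : T -> seq Y) s :
  map f (flatten (map g s)) = flatten (map (fun x => map f (g x)) s).
Proof. by rewrite map_flatten -map_comp. Qed.

Lemma flatten_flatten_map (T Y Z : Type) (f : Y -> seq Z) (g : T -> seq Y) s :
  flatten (map f (flatten (map g s))) =
  flatten (map (fun x => flatten (map f (g x))) s).
Proof. by elim: s => //= x s IH; rewrite map_cat flatten_cat IH. Qed.

Lemma filter_flatten_map (T Y : Type) (p : pred Y) (g : T -> seq Y) s :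
  filter p (flatten (map g s)) = flatten (map (fun x => filter p (g x)) s).
Proof. by rewrite filter_flatten -map_comp. Qed.

Lemma flatten_map_filter (T Y : Type) (p : pred T) (f : T -> Y) s :
  map f (filter p s) = flatten (map (fun x => if p x then [:: f x] else [::]) s).
Proof. by elim: s => //= x s IH; case: (p x) => //=; rewrite IH. Qed.

Lemma flatten_filter_map (T Y : Type) (p : pred T) (f : T -> seq Y) s :
  flatten (map f (filter p s)) = flatten (map (fun x => if p x then f x else [::]) s).
Proof. by elim: s => //= x s IH; case: (p x) => //=; rewrite IH. Qed.

Lemma perm_flatten_map (T : Type) (X : eqType) (f g : T -> seq X) s :
  foldr (fun x Q => perm_eq (f x) (g x) /\ Q) True s ->
  perm_eq (flatten (map f s)) (flatten (map g s)).
Proof. by elim: s => //= x s IH [H /IH]; apply: perm_cat. Qed.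

Lemma perm_flatten_map_cat (T X : eqType) (f g h : T -> seq X) s :
  {in s, forall x, perm_eq (f x ++ g x) (h x)} ->
  perm_eq (flatten (map f s) ++ flatten (map g s)) (flatten (map h s)).
Proof.
elim: s => //= x s IH H; rewrite perm_catACA perm_cat ?H ?mem_head //.
by apply: IH => y ys; rewrite H // inE ys orbT.
Qed.

Lemma uniq_flatten_mem (T X : eqType) (g : T -> seq X) s x :
  uniq (flatten (map g s)) -> x \in s -> uniq (g x).
Proof.
elim: s => //= y s IH; rewrite cat_uniq inE => /and3P[uy _ us].
by case/predU1P => [->//|/(IH us)].
Qed.

End Seq.

(** * Isomorphisms of trees and forests *)

Section TreeIso.
Variables D X : choiceType.
Implicit Types (t : tree D X) (s : seq (X * tree D X)) (F : seq (tree D X)).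

Definition child_class (x : X * tree D X) : X * rtree D X :=
  (x.1, \pi_(rtree D X) x.2).

Lemma pi_tree_iso t t' : \pi_(rtree D X) t = \pi_(rtree D X) t' <-> tree_iso t t'.
Proof. by split => [/eqmodP|H]; last apply/eqmodP. Qed.

Lemma pi_NodeP d s d' s' :
  \pi_(rtree D X) (Node d s) = \pi_(rtree D X) (Node d' s') <->
  d = d' /\ perm_eq (map child_class s) (map child_class s').
Proof.
have E u v : all2 (fun x y : X * tree D X => (x.1 == y.1) && tree_iso x.2 y.2) u v <->
    map child_class u = map child_class v.
  elim: u v => [|x u IH] [|y v] //=; split=> [/andP[/andP[/eqP xy /pi_tree_iso i]]|].
    by move=> /IH->; rewrite /child_class xy i.
  by case=> -> /pi_tree_iso-> /IH->; rewrite eqxx.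
rewrite pi_tree_iso; split => [/tree_isoP[-> [u us /E ->]]|[-> H]].
  by rewrite perm_map.
apply/tree_isoP; split=> //; rewrite perm_sym in H.
have [u us' us] := perm_map_lift H; exists u; first by rewrite perm_sym.
by apply/E; rewrite us.
Qed.

(** An isomorphism is a reordering of the children of the root followed by isomorphisms of the
    subtrees, so it is enough to treat these two moves and transitivity. An entry [q] of [p] holds a
    labelled child [q.1] and the subtree [q.2] that replaces its own. *)
Lemma rtree_ind (R : tree D X -> tree D X -> Prop) :
    (forall t1 t2 t3, R t1 t2 -> R t2 t3 -> R t1 t3) ->
    (forall d s s', perm_eq s s' -> R (Node d s) (Node d s')) ->
    (forall d (p : seq (X * tree D X * tree D X)),
       {in p, forall q, R q.1.2 q.2} ->
       R (Node d [seq q.1 | q <- p]) (Node d [seq (q.1.1, q.2) | q <- p])) ->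
  forall t t', \pi_(rtree D X) t = \pi_(rtree D X) t' -> R t t'.
Proof.
move=> Rt Rp Rc; elim/tree_mem_ind => d s IH [d' s'] /pi_NodeP[<-].
rewrite perm_sym => /perm_map_lift[u su eu]; rewrite perm_sym in su.
apply: Rt (Rp d _ _ su).
have [p [ps pu pin]] : exists p : seq (X * tree D X * tree D X),
    [/\ [seq q.1 | q <- p] = s, [seq (q.1.1, q.2) | q <- p] = u &
        {in p, forall q, q.1 \in s /\ \pi_(rtree D X) q.1.2 = \pi q.2}].
  clear IH su; elim: s u eu => [|x s IHs] [|[y1 y2] u] //=; first by exists [::].
  case=> y1E y2E /IHs[p [<- <- H]]; exists ((x, y2) :: p); split; rewrite /= ?y1E //.
  move=> q; rewrite inE => /predU1P[->|/H[qs ?]] /=; first by rewrite mem_head.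
  by rewrite inE qs orbT.
by rewrite -{1}ps -{1}pu; apply: Rc => q /pin[qs /(IH _ qs)].
Qed.

Lemma monomial_count F x :
  monomial F x = count_mem x (map (fun t => \pi_(rtree D X) t) F).
Proof.
rewrite /monomial; elim: F => [|t F IH]; first by rewrite big_nil cm1.
by rewrite big_cons cmM cmU IH.
Qed.

Lemma monomial_permP F G : monomial F = monomial G <->
  perm_eq (map (fun t => \pi_(rtree D X) t) F) (map (fun t => \pi_(rtree D X) t) G).
Proof.
split=> [H|/seq.permP H]; first by apply/allP => x _ /=; rewrite -!monomial_count H.
by apply/eqP/cmP => x; rewrite !monomial_count H.
Qed.

Lemma monomialP F G : monomial F = monomial G <->
  exists2 F', perm_eq F F' &
  map (fun t => \pi_(rtree D X) t) F' = map (fun t => \pi_(rtree D X) t) G.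
Proof.
split=> [/monomial_permP/perm_map_lift//|[F' FF' H]].
by apply/monomial_permP; rewrite -H perm_map.
Qed.

Lemma monomial_cat F G : monomial (F ++ G) = mmul (monomial F) (monomial G).
Proof. by rewrite /monomial big_cat. Qed.

Lemma monomial_cons t F : monomial (t :: F) = mmul (ucm (\pi_(rtree D X) t)) (monomial F).
Proof. by rewrite /monomial big_cons. Qed.

Lemma monomial_perm F G : perm_eq F G -> monomial F = monomial G.
Proof. by move=> FG; apply/monomialP; exists G. Qed.

Lemma monomial_nil : monomial ([::] : seq (tree D X)) = mone.
Proof. by rewrite /monomial big_nil. Qed.

Lemma monomial_surj (m : {cmonom (rtree D X)}) : exists F, monomial F = m.
Proof.
(* Each class is represented as many times as its exponent in [m]. *)
exists [seq generic_quotient.repr x | x <- flatten [seq nseq (m x) x | x <- finsupp m]].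
apply/eqP/cmP => x; rewrite monomial_count -map_comp.
rewrite (eq_map (g := id)) => [|y /=]; last exact: reprK.
rewrite map_id count_flatten -map_comp sumnE big_map.
under eq_bigr => y _ do rewrite /= count_nseq /=.
have [xm|xm] := boolP (x \in finsupp m).
  rewrite (bigD1_seq x) ?fset_uniq //= eqxx mul1n big1 ?addn0 // => y /negbTE.
  by move=> ->.
rewrite big1_seq => [|y /andP[_ ym]]; first by apply/esym/eqP; rewrite cmE_eq0.
by case: eqP ym xm => [->->|].
Qed.
End TreeIso.

Lemma cat_inj (T : Type) (s1 s2 t1 t2 : seq T) : size s1 = size s2 ->
  s1 ++ t1 = s2 ++ t2 -> s1 = s2 /\ t1 = t2.
Proof.
move=> szs st; split.
  by rewrite -[s1](take_size_cat t1 (erefl _)) st szs take_size_cat.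
by rewrite -[t1](drop_size_cat t1 (erefl (size s1))) st szs drop_size_cat.
Qed.

(** * Relabelling: shapes and lists of labels *)

Section MapTree.
Variable D : Type.

Lemma map_tree_comp (X Y Z : Type) (f : Y -> Z) (g : X -> Y) (t : tree D X) :
  map_tree f (map_tree g t) = map_tree (f \o g) t.
Proof.
elim/tree_nested_ind: t => d s IH /=; congr Node; rewrite -map_comp.
by elim: s IH => //= x s IHs [-> /IHs->].
Qed.

Lemma tree_edges_map (X Y : Type) (f : X -> Y) (t : tree D X) :
  tree_edges (map_tree f t) = map f (tree_edges t).
Proof.
elim/tree_nested_ind: t => d s IH /=.
by elim: s IH => //= x s IHs [-> /IHs->]; rewrite map_cat.
Qed.

Lemma edges_map (X Y : Type) (f : X -> Y) (F : seq (tree D X)) :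
  edges (map (map_tree f) F) = map f (edges F).
Proof.
rewrite /edges map_flatten_map -map_comp; congr flatten.
by apply: eq_map => t /=; rewrite tree_edges_map.
Qed.

(** A planar tree amounts to its shape together with the list [tree_edges] of its labels, which
    reduces relabelling to a question about lists. *)
Definition shape_of (X : Type) (t : tree D X) : tree D unit := map_tree (fun=> tt) t.

Lemma tree_shape_edges_inj (X : Type) (t t' : tree D X) :
  shape_of t = shape_of t' -> tree_edges t = tree_edges t' -> t = t'.
Proof.
have sz Y (u : tree D Y) : size (tree_edges u) = size (tree_edges (shape_of u)).
  by rewrite tree_edges_map size_map.
elim/tree_nested_ind: t t' => d s IH [d' s'] [<- {d'}] H1 H2; congr Node.
elim: s s' IH H1 H2 => [|[x u] s IHs] [|[x' u'] s'] //= [IHu {}/IHs IHs] [uu' ss'].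
case=> -> /cat_inj[|/(IHu _ uu')-> /(IHs _ ss')->//].
by rewrite sz [RHS]sz /shape_of uu'.
Qed.

Lemma tree_relabel (X Y : Type) (t : tree D X) (s : seq Y) :
  size s = size (tree_edges t) ->
  exists2 t', shape_of t' = shape_of t & tree_edges t' = s.
Proof.
elim/tree_nested_ind: t s => d r IH s /= Hs.
suff [r' rE rs] : exists2 r', map (fun x : Y * tree D Y => (tt, shape_of x.2)) r' =
    map (fun x : X * tree D X => (tt, shape_of x.2)) r &
    flatten [seq x.1 :: tree_edges x.2 | x <- r'] = s.
  by exists (Node d r') => //=; congr Node.
elim: r IH s Hs => [|[x t] r IHr] /=.
  by move=> _ [] // _; exists [::].
move=> [IHt /IHr {}IHr] [//|y s] /= [].
rewrite size_cat => szs.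
(* The list is cut after as many labels as the first subtree has edges. *)
have [|t' tt' t's] := IHt (take (size (tree_edges t)) s).
  by rewrite size_takel // szs leq_addr.
have [|r' rr' r's] := IHr (drop (size (tree_edges t)) s).
  by rewrite size_drop szs addKn.
by exists ((y, t') :: r'); rewrite /= ?tt' ?rr' // t's r's cat_take_drop.
Qed.

Lemma forest_shape_edges_inj (X : Type) (F F' : seq (tree D X)) :
  map (@shape_of X) F = map (@shape_of X) F' -> edges F = edges F' -> F = F'.
Proof.
rewrite /edges; elim: F F' => [|t F IH] [|t' F'] //= [tt' FF'].
case/cat_inj => [|/(tree_shape_edges_inj tt')-> /(IH _ FF')->//].
have sz Y (u : tree D Y) : size (tree_edges u) = size (tree_edges (shape_of u)).
  by rewrite tree_edges_map size_map.
by rewrite sz [RHS]sz tt'.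
Qed.

Lemma forest_relabel (X Y : Type) (F : seq (tree D X)) (s : seq Y) :
  size s = size (edges F) ->
  exists2 F', map (@shape_of Y) F' = map (@shape_of X) F & edges F' = s.
Proof.
rewrite /edges; elim: F s => [|t F IH] s /=.
  by case: s => // _; exists [::].
rewrite size_cat => szs.
have [|t' tt' t's] := @tree_relabel _ _ t (take (size (tree_edges t)) s).
  by rewrite size_takel // szs leq_addr.
have [|F' FF' F's] := IH (drop (size (tree_edges t)) s).
  by rewrite size_drop szs addKn.
by exists (t' :: F'); rewrite /= ?tt' ?FF' // t's F's cat_take_drop.
Qed.

Lemma shape_of_map (X Y : Type) (f : X -> Y) (t : tree D X) :
  shape_of (map_tree f t) = shape_of t.
Proof. by rewrite /shape_of map_tree_comp. Qed.

Lemma eq_map_tree_in (X : eqType) (Y : Type) (f g : X -> Y) (t : tree D X) :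
  {in tree_edges t, f =1 g} -> map_tree f t = map_tree g t.
Proof.
move=> fg; apply: tree_shape_edges_inj; first by rewrite !shape_of_map.
by rewrite !tree_edges_map; apply/eq_in_map.
Qed.

(** The function sends an edge of [F] to the label at the same position in [edges G]. The position
    is well defined since each element of [X] occurs exactly once in [edges F]. *)
Lemma forest_map_edges (X : finType) (Y : Type) (F : seq (tree D X)) (G : seq (tree D Y)) :
  map (@shape_of X) F = map (@shape_of Y) G -> perm_eq (edges F) (enum X) ->
  exists f : {ffun X -> Y}, map (map_tree f) F = G.
Proof.
move=> FG Fu; have uF : uniq (edges F) by rewrite (perm_uniq Fu) enum_uniq.
have szE : size (edges F) = size (edges G).
  have sz Z (H : seq (tree D Z)) : size (edges H) = size (edges (map (@shape_of Z) H)).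
    by rewrite edges_map size_map.
  by rewrite sz FG -sz.
have ltX x : (index x (edges F) < size (edges G))%N.
  by rewrite -szE index_mem (perm_mem Fu) mem_enum.
exists [ffun x => tnth (in_tuple (edges G)) (Ordinal (ltX x))].
apply: forest_shape_edges_inj.
  by rewrite -map_comp -FG; apply: eq_map => t /=; rewrite shape_of_map.
rewrite edges_map.
case: (edges G) szE ltX => [/size0nil->//|y0 r] szE ltX.
apply: (@eq_from_nth _ y0); rewrite size_map ?szE // => i iF.
have x0 : X by case: (edges F) szE.
rewrite (nth_map x0) ?szE // ffunE (tnth_nth y0) /= index_uniq ?szE //.
Qed.

End MapTree.

Lemma perm_map_in (T1 T2 : eqType) (f g : T1 -> T2) s :
  {in s, f =1 g} -> perm_eq (map f s) (map g s).
Proof. by move=> /eq_in_map->. Qed.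

(** * Invariance under isomorphism, and lifting of isomorphisms along relabellings *)

Section Invariance.
Variables D X : choiceType.
Implicit Types (t : tree D X) (F : seq (tree D X)).

Lemma pi_map_tree (Y : choiceType) (f : X -> Y) t t' :
  \pi_(rtree D X) t = \pi_(rtree D X) t' ->
  \pi_(rtree D Y) (map_tree f t) = \pi_(rtree D Y) (map_tree f t').
Proof.
move: t t'; apply: rtree_ind => [t1 t2 t3 -> -> //|d s s' ss'|d p Hp];
  apply/pi_NodeP; split=> //.
  by rewrite -!map_comp perm_map.
rewrite -!map_comp; apply: perm_map_in => q /Hp qE.
by rewrite /child_class /= qE.
Qed.

Lemma monomial_flatten (Y : choiceType) (T : eqType) (f g : T -> seq (tree D Y)) s :
  {in s, forall x, monomial (f x) = monomial (g x)} ->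
  monomial (flatten (map f s)) = monomial (flatten (map g s)).
Proof.
elim: s => //= x s IH H; rewrite !monomial_cat H ?mem_head // IH // => y ys.
by rewrite H // inE ys orbT.
Qed.

Lemma monomial_flatten_map (Y : choiceType) (f : tree D X -> seq (tree D Y)) F F' :
    (forall t t', \pi_(rtree D X) t = \pi_(rtree D X) t' ->
       monomial (f t) = monomial (f t')) ->
  monomial F = monomial F' ->
  monomial (flatten (map f F)) = monomial (flatten (map f F')).
Proof.
move=> fE /monomialP[G FG GF'].
rewrite (monomial_perm (perm_flatten (perm_map f FG))).
elim: G F' GF' {FG} => [|t G IH] [|t' F'] //= [/fE tt' /IH GF'].
by rewrite !monomial_cat tt' GF'.
Qed.

Lemma monomial_map (Y : choiceType) (f : tree D X -> tree D Y) F F' :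
    (forall t t', \pi_(rtree D X) t = \pi_(rtree D X) t' ->
       \pi_(rtree D Y) (f t) = \pi_(rtree D Y) (f t')) ->
  monomial F = monomial F' -> monomial (map f F) = monomial (map f F').
Proof.
move=> fE FF'; have E G : map f G = flatten (map (fun t => [:: f t]) G).
  by elim: G => //= ? ? ->.
rewrite !E; apply: monomial_flatten_map => // t t' /fE tt'.
by rewrite /monomial !big_seq1 tt'.
Qed.

Lemma pi_edges t t' :
  \pi_(rtree D X) t = \pi_(rtree D X) t' -> perm_eq (tree_edges t) (tree_edges t').
Proof.
move: t t'; apply: rtree_ind => [t1 t2 t3|d s s' ss'|d p Hp] /=.
- exact: perm_trans.
- exact/perm_flatten/perm_map.
rewrite -!map_comp; elim: p Hp => //= q p IH Hp; rewrite perm_cons perm_cat //.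
  by apply: Hp; rewrite mem_head.
by apply: IH => r rp; apply: Hp; rewrite inE rp orbT.
Qed.

Lemma monomial_edges F F' : monomial F = monomial F' -> perm_eq (edges F) (edges F').
Proof.
case/monomialP=> G FG GF'.
apply: perm_trans (perm_flatten (perm_map (@tree_edges D X) FG)) _.
rewrite /edges; elim: G F' GF' {FG} => [|t G IH] [|t' F'] //= [/pi_edges tt' /IH GF'].
exact: perm_cat.
Qed.

(** An isomorphism only moves children around, so the same moves can be made in [t] before
    relabelling. *)
Lemma pi_map_lift (Y : choiceType) (f : X -> Y) t (u : tree D Y) :
  \pi_(rtree D Y) (map_tree f t) = \pi_(rtree D Y) u ->
  exists2 t', \pi_(rtree D X) t = \pi_(rtree D X) t' & map_tree f t' = u.
Proof.
elim/tree_mem_ind: t u => d s IH [d' r] /pi_NodeP[<-].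
rewrite -map_comp => /perm_map_lift[s' ss' s'r].
suff [s'' s's'' s''r] : exists2 s'', map (@child_class D X) s' = map (@child_class D X) s'' &
    [seq (f x.1, map_tree f x.2) | x <- s''] = r.
  exists (Node d s''); last by rewrite /= s''r.
  by apply/pi_NodeP; split=> //; rewrite -s's'' perm_map.
have {IH ss'} : {in s', forall x, forall u : tree D Y,
    \pi_(rtree D Y) (map_tree f x.2) = \pi_(rtree D Y) u ->
    exists2 t', \pi_(rtree D X) x.2 = \pi_(rtree D X) t' & map_tree f t' = u}.
  by move=> x xs; apply: IH; rewrite (perm_mem ss').
elim: s' r s'r => [|x s' IHs] [|y r] //= s'r IH; first by exists [::].
case: s'r => xy1 xy2 /IHs[|s'' H <-].
  by move=> z zs; apply: IH; rewrite inE zs orbT.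
have [t' xt' t'y] := IH x (mem_head _ _) _ xy2.
exists ((x.1, t') :: s''); first by rewrite /= H /child_class /= xt'.
by rewrite /= t'y xy1; case: (y).
Qed.

Lemma monomial_map_lift (Y : choiceType) (f : X -> Y) F (G : seq (tree D Y)) :
  monomial (map (map_tree f) F) = monomial G ->
  exists2 F', monomial F = monomial F' & map (map_tree f) F' = G.
Proof.
move=> /monomial_permP; rewrite -map_comp => /perm_map_lift[F1 FF1 F1G].
suff [F2 F12 F2G] : exists2 F2, map (fun t => \pi_(rtree D X) t) F1 =
    map (fun t => \pi_(rtree D X) t) F2 & map (map_tree f) F2 = G.
  by exists F2 => //; apply/monomialP; exists F1.
elim: F1 G F1G {FF1} => [|t F1 IH] [|u G] //=; first by exists [::].
case=> /pi_map_lift[t' tt' t'u] /IH[F2 F12 F2G].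
by exists (t' :: F2); rewrite /= ?tt' ?F12 ?t'u ?F2G.
Qed.

End Invariance.

(** * Deletion and contraction of edges *)

Section Operations.
Variables (D : semigroupType) (E : finType).
Implicit Types (I J : {set E}) (t : tree D E) (F : seq (tree D E)).
Local Notation class := (fun t => \pi_(rtree D E) t).

(** The component of the root is compared as a tree. The other components are compared as a
    monomial, since their order depends on the planar structure. *)
Lemma pi_restrict I t t' : \pi_(rtree D E) t = \pi_(rtree D E) t' ->
  \pi_(rtree D E) (restrict_tree I t).1 = \pi_(rtree D E) (restrict_tree I t').1 /\
  monomial (restrict_tree I t).2 = monomial (restrict_tree I t').2.
Proof.
move: t t'; apply: rtree_ind => [t1 t2 t3 [-> ->] [-> ->] //|d s s' ss'|d p Hp].
  split=> /=; last by apply/monomial_perm/perm_flatten/perm_map/perm_map.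
  by apply/pi_NodeP; split=> //; do !apply: perm_map; apply/perm_filter/perm_map.
split=> /=.
  apply/pi_NodeP; split=> //; rewrite !filter_map -!map_comp; apply: perm_map_in => q.
  by rewrite mem_filter => /andP[_ /Hp[qE _]]; rewrite /child_class /= qE.
rewrite -!map_comp; apply: monomial_flatten => q /Hp[q1 q2] /=.
by case: ifP => _ //; rewrite !monomial_cons q1 q2.
Qed.

Lemma monomial_restrict I F F' : monomial F = monomial F' ->
  monomial (restrict I F) = monomial (restrict I F').
Proof.
apply: monomial_flatten_map => t t' /(pi_restrict I)[H1 H2].
by rewrite !monomial_cons H1 H2.
Qed.

Section Contraction.
Hypothesis mulC : commutative (fun x y : D => (x * y)%g).

Lemma foldl_mul_perm s s' (d : D) : perm_eq s s' ->
  foldl (fun p q : D => p * q)%g d s = foldl (fun p q : D => p * q)%g d s'.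
Proof. by apply: foldl_perm => x y _ _ z; rewrite -!mulgA [(x * y)%g]mulC. Qed.

Lemma pi_contract I t t' : \pi_(rtree D E) t = \pi_(rtree D E) t' ->
  \pi_(rtree D E) (contract_tree I t) = \pi_(rtree D E) (contract_tree I t').
Proof.
(* Contracting an edge gives the decoration and the children of its lower end to the upper one
   separately, so the induction has to follow these two pieces. *)
suff H : \pi_(rtree D E) t = \pi_(rtree D E) t' ->
    root_dec (contract_tree I t) = root_dec (contract_tree I t') /\
    perm_eq (map (@child_class D E) (children (contract_tree I t)))
            (map (@child_class D E) (children (contract_tree I t'))).
  by case/H; case: (contract_tree I t) => d s; case: (contract_tree I t') => d' s' ? ?;
    apply/pi_NodeP.
move: t t'; apply: rtree_ind => [t1 t2 t3 [-> H] [-> H'] |d s s' ss'|d p Hp].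
- by split=> //; apply: perm_trans H H'.
- split=> /=; last by apply/perm_map/perm_flatten/perm_map/perm_map.
  by apply/foldl_mul_perm/perm_map/perm_filter/perm_map.
split=> /=.
  congr foldl; rewrite !filter_map -!map_comp; apply/eq_in_map => q.
  by rewrite mem_filter => /andP[_ /Hp[qE _]].
rewrite -!map_comp !map_flatten_map; apply: perm_flatten_map => /=.
elim: p Hp => //= q p IH Hp; split; last first.
  by apply: IH => r rp; apply: Hp; rewrite inE rp orbT.
have [q1 q2] := Hp q (mem_head _ _); case: ifP => //= _; rewrite /child_class /=.
rewrite (_ : class _ = class (contract_tree I q.2)) //.
by case: (contract_tree I _) q1 q2 => d1 s1; case: (contract_tree I _) => d2 s2 ? ?;
  apply/pi_NodeP.
Qed.

Lemma monomial_contract I F F' : monomial F = monomial F' ->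
  monomial (contract I F) = monomial (contract I F').
Proof. by apply: monomial_map => t t'; apply: pi_contract. Qed.
End Contraction.

Lemma tree_above_notin e t : e \notin tree_edges t -> tree_above e t = [::].
Proof.
case: t => d s /= He; apply: flatten_map_nil => x xs; case: ifP => // ex.
by case/negP: He; apply/flatten_mapP; exists x => //; rewrite inE ex orbT.
Qed.

Lemma above_notin e F : e \notin edges F -> above F e = [::].
Proof.
move=> He; apply: flatten_map_nil => t tF; apply: tree_above_notin.
by apply: contra He => et; apply/flatten_mapP; exists t.
Qed.

Lemma tree_above_child e d (s : seq (E * tree D E)) x : uniq (tree_edges (Node d s)) ->
  x \in s -> e \in tree_edges x.2 ->
  tree_above e (Node d s) = x.1 :: tree_above e x.2.
Proof.
move=> us xs ex /=; rewrite (flatten_map_eq us xs (e := e)) ?ex ?inE ?ex ?orbT //.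
by move=> y; rewrite inE negb_or => /andP[_ /negbTE->].
Qed.

Lemma tree_above_root e d (s : seq (E * tree D E)) x : uniq (tree_edges (Node d s)) ->
  x \in s -> e = x.1 -> tree_above e (Node d s) = [::].
Proof.
move=> us xs ex /=; rewrite (flatten_map_eq us xs (e := e)) ?inE ?ex ?eqxx //.
  have := uniq_flatten_mem us xs; rewrite /= -ex => /andP[/negbTE-> //].
by move=> y; rewrite inE negb_or => /andP[_ /negbTE->].
Qed.

Lemma above_tree e t F : uniq (edges F) -> t \in F -> e \in tree_edges t ->
  above F e = tree_above e t.
Proof.
by move=> uF tF et; apply: (flatten_map_eq uF tF et) => u; apply: tree_above_notin.
Qed.

(** The labels being distinct, at most one block is nonempty, and the order of the blocks is
    irrelevant. *)
Lemma flatten_map_perm_eq (T : eqType) (g : T -> seq E) (f : T -> seq E) s s' e :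
  uniq (flatten (map g s)) -> perm_eq s s' -> (forall y, e \notin g y -> f y = [::]) ->
  flatten (map f s) = flatten (map f s').
Proof.
move=> us ss' fg; have us' : uniq (flatten (map g s')).
  by rewrite -(perm_uniq (perm_flatten (perm_map g ss'))).
have [/hasP[x xs ex]|/hasPn H] := boolP (has (fun x => e \in g x) s).
  by rewrite (flatten_map_eq us xs ex) // (flatten_map_eq us' _ ex) // -(perm_mem ss').
by rewrite !flatten_map_nil // => x; rewrite -?(perm_mem ss') => /H/fg.
Qed.

Lemma pi_above t t' e : \pi_(rtree D E) t = \pi_(rtree D E) t' ->
  uniq (tree_edges t) -> tree_above e t = tree_above e t'.
Proof.
(* The permutation of the edges is carried along to transport distinctness of labels through
   transitivity. *)
move=> tt'; suff: perm_eq (tree_edges t) (tree_edges t') /\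
    (uniq (tree_edges t) -> tree_above e t = tree_above e t') by case.
move: t t' tt'; apply: rtree_ind => [t1 t2 t3 [H1 H2] [H3 H4]|d s s' ss'|d p Hp].
- split; first exact: perm_trans H1 H3.
  by move=> u1; rewrite H2 ?H4 // -(perm_uniq H1).
- split=> [|us]; first exact: (perm_flatten (perm_map _ ss')).
  apply: (flatten_map_perm_eq (e := e) us ss') => y.
  by rewrite inE negb_or => /andP[_ /negbTE->].
rewrite /= -!map_comp; split.
  apply: perm_flatten_map; elim: p Hp => //= q p IH Hp; rewrite perm_cons.
  split; first by case: (Hp q (mem_head _ _)).
  by apply: IH => r rp; apply: Hp; rewrite inE rp orbT.
move=> up; congr flatten; apply/eq_in_map => q qp /=; have [H1 H2] := Hp q qp.
have /andP[_ /H2->] := uniq_flatten_mem up qp.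
by rewrite (perm_mem H1).
Qed.

Lemma monomial_above F F' e : monomial F = monomial F' -> uniq (edges F) ->
  above F e = above F' e.
Proof.
case/monomialP=> G FG GF' uF.
rewrite /above (flatten_map_perm_eq uF FG (e := e)); last exact: tree_above_notin.
have {uF FG} uG : uniq (edges G).
  by rewrite -(perm_uniq (perm_flatten (perm_map (@tree_edges D E) FG))).
elim: G F' GF' uG => [|t G IH] [|t' F'] //= [/pi_above tt' /IH GF'].
by rewrite cat_uniq => /and3P[/(tt' e)-> _ /GF' ->].
Qed.

End Operations.

(** * Deletion, contraction and ancestors under relabelling *)

Section Naturality.
Variables (D : semigroupType) (E E' : finType) (f : E -> E').
Variables (I : {set E}) (I' : {set E'}).
Hypothesis fI : forall e, (f e \in I') = (e \in I).
Implicit Types (t : tree D E) (F : seq (tree D E)).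

Lemma restrict_tree_map t : restrict_tree I' (map_tree f t) =
  (map_tree f (restrict_tree I t).1, map (map_tree f) (restrict_tree I t).2).
Proof.
elim/tree_mem_ind: t => d s IH /=; rewrite !filter_map -!map_comp.
rewrite (eq_filter (a2 := fun x => x.1 \in I)) => [|x] /=; last by rewrite fI.
congr (Node _ _, _).
  by apply/eq_in_map => x; rewrite mem_filter => /andP[_ /IH xE]; rewrite /= xE.
rewrite map_flatten_map; congr flatten; apply/eq_in_map => x /IH xE /=.
by rewrite fI xE; case: ifP.
Qed.

Lemma restrict_map F :
  restrict I' (map (map_tree f) F) = map (map_tree f) (restrict I F).
Proof.
rewrite /restrict map_flatten_map -map_comp; congr flatten.
by apply: eq_map => t /=; rewrite restrict_tree_map.
Qed.

Lemma contract_tree_map t :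
  contract_tree I' (map_tree f t) = map_tree f (contract_tree I t).
Proof.
have rd u : root_dec (map_tree f u) = root_dec u by case: u.
have ch u : children (map_tree f u) = [seq (f x.1, map_tree f x.2) | x <- children u].
  by case: u.
elim/tree_mem_ind: t => d s IH /=; rewrite !filter_map -!map_comp.
rewrite (eq_filter (a2 := fun x => x.1 \in I)) => [|x] /=; last by rewrite fI.
congr (Node _ _).
  congr foldl; apply/eq_in_map => x.
  by rewrite mem_filter => /andP[_ /IH xE]; rewrite /= xE rd.
rewrite map_flatten_map; congr flatten; apply/eq_in_map => x /IH xE /=.
by rewrite fI xE; case: ifP => // _; rewrite ch.
Qed.

Lemma contract_map F :
  contract I' (map (map_tree f) F) = map (map_tree f) (contract I F).
Proof.
by rewrite /contract -!map_comp; apply: eq_map => t /=; rewrite contract_tree_map.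
Qed.

Hypothesis f_inj : injective f.

Lemma tree_above_map e t :
  tree_above (f e) (map_tree f t) = map f (tree_above e t).
Proof.
elim/tree_mem_ind: t => d s IH /=.
rewrite map_flatten_map -map_comp; congr flatten; apply/eq_in_map => x /IH xE /=.
by rewrite tree_edges_map mem_map // xE; case: ifP.
Qed.

Lemma above_map e F : above (map (map_tree f) F) (f e) = map f (above F e).
Proof.
rewrite /above map_flatten_map -map_comp; congr flatten.
by apply: eq_map => t /=; rewrite tree_above_map.
Qed.

End Naturality.

(** * The final part of a path that lies in a set of edges *)

Section Run.
Variable E : finType.
Implicit Types (I J K : {set E}) (q : seq E).

(** The longest suffix of [q] with all its entries in [I]; for [q := above F e] it is
    [path_above I F e]. *)
Definition run I q := foldl (fun p e => if e \in I then rcons p e else [::]) [::] q.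

Lemma run_rcons I q x : run I (rcons q x) = if x \in I then rcons (run I q) x else [::].
Proof. by rewrite /run foldl_rcons. Qed.

Lemma run_in I q x : x \in run I q -> x \in I.
Proof.
elim/last_ind: q => // q y IH; rewrite run_rcons.
by case: ifP => // yI; rewrite mem_rcons inE => /predU1P[->|].
Qed.

Lemma run_cons I x q : run I (x :: q) =
  if (x \in I) && all (mem I) q then x :: q else run I q.
Proof.
elim/last_ind: q => [|q y IH]; first by rewrite /run /= andbT.
rewrite -rcons_cons !run_rcons IH all_rcons /=.
by case: (y \in I); rewrite ?andbF //=; case: ifP.
Qed.

Lemma run_all I q : all (mem I) q -> run I q = q.
Proof. by elim: q => // x q IH /= /andP[xI qI]; rewrite run_cons /= xI qI. Qed.

(** An entry outside [I] is also outside [J], so what [run I] discards would be discarded by [run J]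
    as well. *)
Lemma run_run I J q : J \subset I -> run J (run I q) = run J q.
Proof.
move=> JI; elim/last_ind: q => // q x IH; rewrite !run_rcons.
case: ifP => xI; first by rewrite run_rcons IH.
by case: ifP => // /(subsetP JI); rewrite xI.
Qed.

(** A contracted edge disappears from the path without interrupting it, so a run in [K] after
    contraction of [J] comes from a run in [J :|: K]. *)
Lemma run_filter J K q : [disjoint J & K] ->
  run K [seq x <- q | x \notin J] = [seq x <- run (J :|: K) q | x \notin J].
Proof.
move=> JK; elim/last_ind: q => // q x IH; rewrite filter_rcons run_rcons !inE.
have [xJ|xJ] /= := boolP (x \in J); first by rewrite filter_rcons xJ.
by rewrite run_rcons IH; case: ifP => // _; rewrite filter_rcons xJ.
Qed.

End Run.

Lemma run_map (E E' : finType) (f : E -> E') (I : {set E}) (I' : {set E'}) q :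
  (forall e, (f e \in I') = (e \in I)) -> run I' (map f q) = map f (run I q).
Proof.
move=> fI; elim/last_ind: q => // q x IH.
by rewrite map_rcons !run_rcons fI IH; case: ifP => // _; rewrite map_rcons.
Qed.

(** * Iterated deletions and contractions *)

Section Composition.
Variables (D : semigroupType) (E : finType).
Implicit Types (I J K : {set E}) (t : tree D E) (F : seq (tree D E)).

Lemma path_aboveE I F e : path_above I F e = run I (above F e).
Proof. by []. Qed.

Lemma restrict_cat I F G : restrict I (F ++ G) = restrict I F ++ restrict I G.
Proof. by rewrite /restrict map_cat flatten_cat. Qed.

Lemma restrict_cons I t F :
  restrict I (t :: F) = (restrict_tree I t).1 :: (restrict_tree I t).2 ++ restrict I F.
Proof. by []. Qed.

Lemma edges_cat F G : edges (F ++ G) = edges F ++ edges G.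
Proof. by rewrite /edges map_cat flatten_cat. Qed.

Lemma restrict_flatten (T : Type) I (f : T -> seq (tree D E)) s :
  restrict I (flatten (map f s)) = flatten (map (fun x => restrict I (f x)) s).
Proof. by rewrite /restrict flatten_flatten_map. Qed.

Lemma edges_flatten (T : Type) (f : T -> seq (tree D E)) s :
  edges (flatten (map f s)) = flatten (map (fun x => edges (f x)) s).
Proof. by rewrite /edges flatten_flatten_map. Qed.

Lemma tree_edges_restrict I t : perm_eq
  (tree_edges (restrict_tree I t).1 ++ edges (restrict_tree I t).2)
  [seq e <- tree_edges t | e \in I].
Proof.
elim/tree_mem_ind: t => d s IH /=; rewrite filter_flatten_map edges_flatten.
rewrite filter_map -map_comp flatten_map_filter flatten_flatten_map -map_comp /=.
apply: perm_flatten_map_cat => x /IH H /=.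
by case: ifP => xI /=; rewrite ?cats0 ?perm_cons.
Qed.

Lemma edges_restrict I F :
  perm_eq (edges (restrict I F)) [seq e <- edges F | e \in I].
Proof.
rewrite [X in perm_eq X]edges_flatten filter_flatten_map; apply: perm_flatten_map.
by elim: F => //= t F IH; split => //; apply: tree_edges_restrict.
Qed.

Lemma tree_edges_contract I t :
  tree_edges (contract_tree I t) = [seq e <- tree_edges t | e \notin I].
Proof.
have te u : tree_edges u = flatten [seq x.1 :: tree_edges x.2 | x <- children u] by case: u.
elim/tree_mem_ind: t => d s IH /=; rewrite filter_flatten_map flatten_flatten_map -map_comp.
congr flatten; apply/eq_in_map => x /IH H /=.
by case: ifP => xI /=; rewrite -?te ?cats0 H.
Qed.

Lemma edges_contract I F : edges (contract I F) = [seq e <- edges F | e \notin I].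
Proof.
rewrite /edges /contract filter_flatten_map -map_comp; congr flatten.
by apply: eq_map => t; apply: tree_edges_contract.
Qed.

(** The components of the root agree exactly, but deleting in two rounds lists the other components
    in a different order. *)
Lemma restrict_tree_restrict I J t : J \subset I ->
  (restrict_tree J (restrict_tree I t).1).1 = (restrict_tree J t).1 /\
  perm_eq ((restrict_tree J (restrict_tree I t).1).2 ++ restrict J (restrict_tree I t).2)
          (restrict_tree J t).2.
Proof.
move=> JI; elim/tree_mem_ind: t => d s IH /=; split.
  congr Node; rewrite !filter_map -!map_comp -filter_predI.
  rewrite (eq_filter (a2 := fun x => x.1 \in J)) => [|x] /=; last first.
    by case xJ: (_ \in J) => //=; apply: (subsetP JI).
  by apply/eq_in_map => x; rewrite mem_filter => /andP[_ /IH[xE _]]; rewrite /= xE.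
rewrite restrict_flatten filter_map -!map_comp.
rewrite flatten_filter_map.
apply: perm_flatten_map_cat => x /IH[x1 x2] /=.
case xI: (x.1 \in I) => /=; last first.
  case xJ: (x.1 \in J); first by rewrite (subsetP JI _ xJ) in xI.
  by rewrite restrict_cons x1 /= perm_cons.
by case xJ: (x.1 \in J); rewrite /= ?x1 ?perm_cons.
Qed.

Lemma restrict_restrict I J F : J \subset I ->
  perm_eq (restrict J (restrict I F)) (restrict J F).
Proof.
move=> JI; rewrite [X in perm_eq X]restrict_flatten; apply: perm_flatten_map.
elim: F => //= t F IH; split=> //.
by have [H1 H2] := restrict_tree_restrict t JI; rewrite restrict_cons H1 perm_cons.
Qed.

(** Deletion outside [J :|: K] and contraction of [J] concern different edges and therefore commute,
    here even as operations on planar trees. *)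
Lemma contract_tree_restrict J K t : [disjoint J & K] ->
  contract_tree J (restrict_tree (J :|: K) t).1 = (restrict_tree K (contract_tree J t)).1 /\
  contract J (restrict_tree (J :|: K) t).2 = (restrict_tree K (contract_tree J t)).2.
Proof.
move=> JK; have rd u : root_dec (restrict_tree K u).1 = root_dec u by case: u.
have ch u : children (restrict_tree K u).1 =
    [seq (x.1, (restrict_tree K x.2).1) | x <- children u & x.1 \in K].
  by case: u => d s /=; rewrite filter_map -map_comp.
have co u : (restrict_tree K u).2 = flatten [seq if x.1 \in K then (restrict_tree K x.2).2
    else (restrict_tree K x.2).1 :: (restrict_tree K x.2).2 | x <- children u].
  by case: u => d s /=; rewrite -map_comp.
elim/tree_mem_ind: t => d s IH /=; split; last first.
  rewrite /contract map_flatten_map -!map_comp flatten_flatten_map.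
  congr flatten; apply/eq_in_map => x /IH[x1 x2] /=; rewrite inE.
  case xJ: (x.1 \in J) => /=; first by rewrite -/(contract _ _) x2 co.
  by case: ifP => xK /=; rewrite cats0 -/(contract _ _) ?x1 x2.
congr Node.
  congr foldl; rewrite !filter_map -!map_comp -filter_predI.
  rewrite (eq_filter (a2 := fun x => x.1 \in J)) => [|x] /=; last first.
    by rewrite inE; case: (x.1 \in J).
  by apply/eq_in_map => x; rewrite mem_filter => /andP[_ /IH[xE _]]; rewrite /= xE rd.
rewrite !filter_map -!map_comp filter_flatten_map map_flatten_map.
rewrite flatten_filter_map; congr flatten; apply/eq_in_map => x /IH[x1 x2] /=.
rewrite inE; case xJ: (x.1 \in J) => /=; first by rewrite x1 ch.
by case: ifP => //= _; rewrite x1.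
Qed.

Lemma contract_restrict J K F : [disjoint J & K] ->
  contract J (restrict (J :|: K) F) = restrict K (contract J F).
Proof.
move=> JK; rewrite /contract /restrict map_flatten_map -map_comp; congr flatten.
apply: eq_map => t /=; have [<- <-] := contract_tree_restrict t JK; by [].
Qed.

Section Contraction.
Hypothesis mulC : commutative (fun x y : D => (x * y)%g).
Local Notation prod := (foldl (fun p q : D => p * q)%g).

Lemma foldl_mulA (a b : D) s : prod (a * b)%g s = (a * prod b s)%g.
Proof. by elim: s b => //= c s IH b; rewrite -mulgA IH. Qed.

Lemma contract_tree_contract J K t : [disjoint J & K] ->
  contract_tree K (contract_tree J t) = contract_tree (J :|: K) t.
Proof.
move=> JK; have rd u : root_dec (contract_tree K u) =
    prod (root_dec u) [seq root_dec (contract_tree K x.2) | x <- children u & x.1 \in K].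
  by case: u => d s /=; rewrite filter_map -map_comp.
have ch u : children (contract_tree K u) = flatten [seq if x.1 \in K then
    children (contract_tree K x.2) else [:: (x.1, contract_tree K x.2)] | x <- children u].
  by case: u => d s /=; rewrite -map_comp.
elim/tree_mem_ind: t => d s IH /=; congr Node; last first.
  rewrite -!map_comp flatten_flatten_map; congr flatten; apply/eq_in_map => x /IH xE /=.
  rewrite inE -xE; case xJ: (x.1 \in J) => /=; first by rewrite ch.
  by case: ifP => //= xK; rewrite ?cats0.
rewrite !filter_map -!map_comp filter_flatten_map map_flatten_map.
rewrite (flatten_map_filter (fun x => x.1 \in J)) (flatten_map_filter (fun x => x.1 \in _)).
rewrite -foldl_cat.
(* For a child [x] of the root, [A x] and [B x] are the factors that it brings to the root
   decoration when [J] and then [K] are contracted, and [C x] is its factor when both are contracted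
   at once. *)
pose A (x : E * tree D E) := if x.1 \in J then [:: root_dec (contract_tree J x.2)] else [::].
pose B (x : E * tree D E) := [seq root_dec (contract_tree K c.2) | c <- if x.1 \in J then
  children (contract_tree J x.2) else [:: (x.1, contract_tree J x.2)] & c.1 \in K].
pose C (x : E * tree D E) := if x.1 \in J :|: K then
  [:: root_dec (contract_tree (J :|: K) x.2)] else [::].
have ABC x a : x \in s -> prod a (A x ++ B x) = prod a (C x).
  move=> /IH xE; rewrite /A /B /C inE -xE; case xJ: (x.1 \in J) => /=.
    by rewrite rd foldl_mulA.
  by case: ifP.
transitivity (prod d (flatten (map A s) ++ flatten (map B s))).
  by congr foldl; congr cat; congr flatten; apply: eq_map => x; rewrite /B /=; case: ifP.
(* Contracting twice multiplies all the [A x] before all the [B x]; commutativity regroups the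
   factors child by child. *)
rewrite (foldl_mul_perm mulC (s' := flatten (map (fun x => A x ++ B x) s))); last first.
  by apply: perm_flatten_map_cat.
transitivity (prod d (flatten (map C s))) => //.
elim: s d {IH} ABC => //= x s IHs d ABC; rewrite foldl_cat [RHS]foldl_cat ABC ?mem_head //.
by apply: IHs => y a ys; apply: ABC; rewrite inE ys orbT.
Qed.

Lemma contract_contract J K F : [disjoint J & K] ->
  contract K (contract J F) = contract (J :|: K) F.
Proof.
move=> JK; rewrite /contract -map_comp; apply: eq_map => t /=.
exact: contract_tree_contract.
Qed.
End Contraction.

Lemma restrict_tree_full t : restrict_tree setT t = (t, [::]).
Proof.
elim/tree_mem_ind: t => d s IH /=; rewrite filter_map -!map_comp.
rewrite flatten_map_nil => [|x /IH xE] /=; last by rewrite inE xE.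
congr (Node _ _, _); rewrite (eq_filter (a2 := predT)) => [|x] /=; last by rewrite inE.
by rewrite filter_predT -[RHS]map_id; apply/eq_in_map => -[e u] /IH /= ->.
Qed.

Lemma restrict_full F : restrict setT F = F.
Proof. by elim: F => //= t F IH; rewrite restrict_cons restrict_tree_full IH. Qed.

Lemma contract_tree0 t : contract_tree set0 t = t.
Proof.
elim/tree_mem_ind: t => d s IH /=; rewrite filter_map -!map_comp.
rewrite (eq_filter (a2 := pred0)) => [|x] /=; last by rewrite inE.
rewrite filter_pred0; congr Node.
elim: s IH => //= -[e u] s IHs IH; rewrite inE /= (IH _ (mem_head _ _)) IHs // => y ys.
by rewrite IH // inE ys orbT.
Qed.

Lemma contract0 F : contract set0 F = F.
Proof. by elim: F => //= t F ->; rewrite contract_tree0. Qed.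

End Composition.

(** * Edges above an edge *)

Section Ancestors.
Variables (D : semigroupType) (E : finType).
Implicit Types (I J K : {set E}) (t : tree D E) (F : seq (tree D E)).

Lemma tree_above_contract J e t : e \notin J ->
  tree_above e (contract_tree J t) = [seq x <- tree_above e t | x \notin J].
Proof.
move=> eJ; have ta u : tree_above e u = flatten [seq if e \in tree_edges x.2
    then x.1 :: tree_above e x.2 else [::] | x <- children u] by case: u.
elim/tree_mem_ind: t => d s IH /=.
rewrite filter_flatten_map flatten_flatten_map -map_comp; congr flatten.
apply/eq_in_map => x /IH xE /=.
have [xJ|xJ] := boolP (x.1 \in J).
  by rewrite -ta xE; case: ifP => /= [_|/negbT/tree_above_notin->//]; rewrite xJ.
rewrite /= cats0 tree_edges_contract mem_filter eJ /=.
by case: ifP => //= _; rewrite xJ xE.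
Qed.

Lemma above_contract J e F : e \notin J ->
  above (contract J F) e = [seq x <- above F e | x \notin J].
Proof.
move=> eJ; rewrite /above /contract filter_flatten_map -map_comp; congr flatten.
by apply: eq_map => t; apply: tree_above_contract.
Qed.

Lemma uniq_restrict_tree I t : uniq (tree_edges t) ->
  uniq (tree_edges (restrict_tree I t).1 ++ edges (restrict_tree I t).2).
Proof. by move=> ut; rewrite (perm_uniq (tree_edges_restrict I t)) filter_uniq. Qed.

(** If no deleted edge lies above [f], it stays in the component of the root with its whole path.
    Otherwise its component is rooted at the lower end of the last deleted edge above it, and its
    path starts there. *)
Lemma tree_above_restrict I f t : uniq (tree_edges t) -> f \in I -> f \in tree_edges t ->
  let r := restrict_tree I t in
  if all (mem I) (tree_above f t) then
    f \in tree_edges r.1 /\ tree_above f r.1 = tree_above f t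
  else f \in edges r.2 /\ above r.2 f = run I (tree_above f t).
Proof.
move=> + fI; elim/tree_mem_ind: t => d s IH us ft.
have urs := uniq_restrict_tree I us.
have /flatten_mapP[x xs fx] := ft.
have ux : uniq (tree_edges x.2) by have /andP[] := uniq_flatten_mem us xs.
set r := restrict_tree I (Node d s).
have r1x : x.1 \in I -> (x.1, (restrict_tree I x.2).1) \in children r.1.
  move=> xI; rewrite /r /= filter_map -!map_comp; apply/mapP; exists x => //.
  by rewrite mem_filter /= xI.
have r1E : r.1 = Node d (children r.1) by [].
have r2x u : u \in (if x.1 \in I then (restrict_tree I x.2).2
    else (restrict_tree I x.2).1 :: (restrict_tree I x.2).2) -> u \in r.2.
  by move=> ur; rewrite /r /= -map_comp; apply/flatten_mapP; exists x.
have [ur1 ur2] : uniq (tree_edges r.1) /\ uniq (edges r.2).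
  by move: urs; rewrite cat_uniq => /and3P[].
clearbody r; move: fx; rewrite inE => /predU1P[fx|fx].
  (* First case: [f] is the edge from the root to the child [x], with nothing above it. *)
  rewrite (tree_above_root us xs fx) /=; have xI : x.1 \in I by rewrite -fx.
  split; last by rewrite r1E; apply: (tree_above_root _ (r1x xI)) => //; rewrite -r1E.
  by rewrite r1E; apply/flatten_mapP; exists (x.1, (restrict_tree I x.2).1);
    rewrite ?r1x // inE fx eqxx.
rewrite (tree_above_child us xs fx) /=.
have /= := IH x xs ux fx; have [xI|xI] /= := boolP (x.1 \in I).
  case: ifP => [_ [fr fE]|qI [fr fE]].
    split; first by rewrite r1E; apply/flatten_mapP; exists (x.1, (restrict_tree I x.2).1);
      rewrite ?r1x // inE fr orbT.
    by rewrite r1E (tree_above_child _ (r1x xI) fr) -?r1E // fE.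
  rewrite run_cons xI qI /= -fE.
  have /flatten_mapP[u uR fu] := fr.
  have ur : u \in r.2 by apply: r2x; rewrite xI.
  split; first by apply/flatten_mapP; exists u.
  rewrite (above_tree ur2 ur fu) (above_tree _ uR fu) //.
  by have := uniq_restrict_tree I ux; rewrite cat_uniq => /and3P[].
(* Now [x.1] is deleted, and the whole restriction of the subtree, its root component included, goes
   to the second list. *)
have xr := r2x _ _; rewrite (negbTE xI) in xr.
case: ifP => [qI [fr fE]|qI [fr fE]]; rewrite run_cons (negbTE xI) /=.
  have ur : (restrict_tree I x.2).1 \in r.2 by apply: xr; rewrite mem_head.
  split; first by apply/flatten_mapP; exists (restrict_tree I x.2).1.
  by rewrite (above_tree ur2 ur fr) fE run_all.
have /flatten_mapP[u uR fu] := fr.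
have ur : u \in r.2 by apply: xr; rewrite inE uR orbT.
split; first by apply/flatten_mapP; exists u.
rewrite (above_tree ur2 ur fu) -fE (above_tree _ uR fu) //.
by have := uniq_restrict_tree I ux; rewrite cat_uniq => /and3P[].
Qed.

Lemma above_restrict I f F : uniq (edges F) -> f \in I -> f \in edges F ->
  above (restrict I F) f = run I (above F f).
Proof.
move=> uF fI fF; have urF : uniq (edges (restrict I F)).
  by rewrite (perm_uniq (edges_restrict I F)) filter_uniq.
have /flatten_mapP[t tF ft] := fF; have ut := uniq_flatten_mem uF tF.
rewrite (above_tree uF tF ft).
have rF u : u \in (restrict_tree I t).1 :: (restrict_tree I t).2 -> u \in restrict I F.
  by move=> ur; apply/flatten_mapP; exists t.
have /= := tree_above_restrict ut fI ft; case: ifP => [qI [fr fE]|_ [fr fE]].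
  by rewrite (above_tree urF (rF _ (mem_head _ _)) fr) fE run_all.
have /flatten_mapP[u uR fu] := fr.
have ur : u \in restrict I F by apply: rF; rewrite inE uR orbT.
rewrite (above_tree urF ur fu) -fE (above_tree _ uR fu) //.
by have := uniq_restrict_tree I ut; rewrite cat_uniq => /and3P[].
Qed.

(** The path to an edge met on the way to [e] is the part of the way already covered. This supports
    the later induction along a path. *)
Lemma tree_above_prefix e f t q1 q2 : uniq (tree_edges t) ->
  tree_above e t = q1 ++ f :: q2 -> f \in tree_edges t /\ tree_above f t = q1.
Proof.
elim/tree_mem_ind: t q1 => d s IH q1 us.
have [/hasP[x xs ex]|/hasPn H] := boolP (has (fun x => e \in tree_edges x.2) s); last first.
  by rewrite /= flatten_map_nil; [case: q1|move=> x /H/negbTE->].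
rewrite (tree_above_child us xs ex).
have ux : uniq (tree_edges x.2) by have /andP[] := uniq_flatten_mem us xs.
case: q1 => [|y q1] [xE qE].
  split; last by apply: (tree_above_root us xs).
  by apply/flatten_mapP; exists x => //; rewrite inE xE eqxx.
have [fx qx] := IH x xs q1 ux qE.
split; last by rewrite (tree_above_child us xs fx) qx xE.
by apply/flatten_mapP; exists x => //; rewrite inE fx orbT.
Qed.

Lemma above_prefix e f F q1 q2 : uniq (edges F) ->
  above F e = q1 ++ f :: q2 -> f \in edges F /\ above F f = q1.
Proof.
move=> uF; have [eF|/above_notin->] := boolP (e \in edges F); last by case: q1.
have /flatten_mapP[t tF et] := eF; rewrite (above_tree uF tF et).
case/(tree_above_prefix (uniq_flatten_mem uF tF)) => ft <-.
by rewrite (above_tree uF tF ft); split=> //; apply/flatten_mapP; exists t.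
Qed.

End Ancestors.

(** * The action of Phi on two factors *)

Section Tensors.
Variables (K : fieldType) (A : vectType K).
Local Notation B := (bidx A).

Lemma upd2l (E : finType) (b : {ffun E -> B}) x y i j : upd2 b x y i j x = i.
Proof. by rewrite ffunE eqxx. Qed.

Lemma upd2r (E : finType) (b : {ffun E -> B}) x y i j :
  x != y -> upd2 b x y i j y = j.
Proof. by rewrite ffunE eq_sym => /negbTE->; rewrite eqxx. Qed.

Lemma upd2_out (E : finType) (b : {ffun E -> B}) x y i j z :
  z != x -> z != y -> upd2 b x y i j z = b z.
Proof. by rewrite ffunE => /negbTE-> /negbTE->. Qed.

(** With [slice f b], the indices of the factors outside the image of [f] are frozen at [b], so an
    identity between maps that act on the image can be checked on [E]. *)
Definition glue (E E' : finType) (f : E -> E') (b : {ffun E' -> B}) (c : {ffun E -> B}) :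
    {ffun E' -> B} :=
  [ffun e' => if [pick e | f e == e'] is Some e then c e else b e'].

Definition slice (E E' : finType) (f : E -> E') (b : {ffun E' -> B}) (t : tpow A E') :
    tpow A E := [ffun c => t (glue f b c)].

Lemma act2E (E : finType) g (x y : E) (t : tpow A E) b :
  act2 g x y t b = (g (\matrix_(i, j) t (upd2 b x y i j)) : 'M__) (b x) (b y).
Proof. by rewrite ffunE. Qed.

Section Slice.
Variables (E E' : finType) (f : E -> E').
Hypothesis f_inj : injective f.

Lemma glue_comp (b : {ffun E' -> B}) : glue f b [ffun e => b (f e)] = b.
Proof. by apply/ffunP => e'; rewrite ffunE; case: pickP => // e /eqP <-; rewrite ffunE. Qed.

Lemma glueE (b : {ffun E' -> B}) (c : {ffun E -> B}) e : glue f b c (f e) = c e.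
Proof. by rewrite ffunE; case: pickP => [e1 /eqP/f_inj->//|/(_ e)]; rewrite eqxx. Qed.

Lemma slice_act2 g b x y (t : tpow A E') :
  slice f b (act2 g (f x) (f y) t) = act2 g x y (slice f b t).
Proof.
apply/ffunP => c; rewrite [LHS]ffunE !act2E !glueE; congr ((g _ : 'M__) _ _).
apply/matrixP => i j; rewrite !mxE [RHS]ffunE; congr (t _).
apply/ffunP => e'; rewrite !ffunE; case: pickP => [e /eqP<-|e'f].
  by rewrite !(inj_eq f_inj) !ffunE.
by rewrite ![e' == _]eq_sym !e'f.
Qed.

Lemma slice_inj (t t' : tpow A E') : (forall b, slice f b t = slice f b t') -> t = t'.
Proof.
move=> H; apply/ffunP => b.
have := congr1 (fun u : tpow A E => u [ffun e => b (f e)]) (H b).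
by rewrite !ffunE glue_comp.
Qed.
End Slice.

(** * Permutations of the tensor factors *)

Section PermAct.
Variables (E : finType).
Implicit Types (s : {perm E}) (t : tpow A E).

Definition permT s t : tpow A E := [ffun c : {ffun E -> B} => t [ffun e => c (s e)]].

Lemma permT_comp s s' t : permT s (permT s' t) = permT (s' * s)%g t.
Proof.
by apply/ffunP => c; rewrite !ffunE; congr (t _); apply/ffunP => e; rewrite !ffunE permM.
Qed.

Lemma permTK x y : involutive (permT (tperm x y)).
Proof.
move=> t; rewrite permT_comp tperm2; apply/ffunP => c; rewrite !ffunE; congr (t _).
by apply/ffunP => e; rewrite !ffunE perm1.
Qed.

Lemma permT_inj s : injective (permT s).
Proof.
move=> t t' H; apply/ffunP => c.
have := congr1 (fun u : tpow A E => u [ffun e => c (s^-1 e)%g]) H; rewrite !ffunE.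
by set c' := [ffun _ => _]; have -> : c' = c by apply/ffunP => e; rewrite !ffunE permK.
Qed.

Lemma act2_permT g s x y t :
  act2 g (s x) (s y) (permT s t) = permT s (act2 g x y t).
Proof.
apply/ffunP => c; rewrite !ffunE; congr ((g _ : 'M__) _ _).
apply/matrixP => i j; rewrite !mxE !ffunE; congr (t _).
by apply/ffunP => e; rewrite !ffunE !(inj_eq perm_inj).
Qed.

Lemma act2_flip x y t : x != y -> act2 (@flip K A) x y t = permT (tperm x y) t.
Proof.
move=> xy; apply/ffunP => c; rewrite !ffunE /flip !mxE; congr (t _).
apply/ffunP => e; rewrite !ffunE; case: tpermP => [->|->|/eqP/negbTE-> /eqP/negbTE-> //].
  by rewrite eqxx.
by rewrite eq_sym (negbTE xy) eqxx.
Qed.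

(** The flip being an involution, [g] is the flip after [flip \o g]. The axioms on [Phi] thereby
    become identities between maps [psi] and permutations of factors. *)
Lemma act2_flip_comp g x y t : x != y ->
  act2 g x y t = permT (tperm x y) (act2 (@flip K A \o g) x y t).
Proof.
move=> xy; apply/ffunP => c; rewrite !ffunE /= tpermL tpermR /flip mxE.
congr ((g _ : 'M__) _ _); apply/matrixP => i j; rewrite !mxE; congr (t _).
apply/ffunP => e; rewrite !ffunE; case: eqP => // /eqP ex; case: eqP => // /eqP ey.
by rewrite tpermD // eq_sym.
Qed.

Lemma tperm_braid (x y z : E) : x != y -> y != z -> x != z ->
  (tperm x y * tperm y z * tperm x y = tperm y z * tperm x y * tperm y z)%g.
Proof.
move=> xy yz xz; have -> : (tperm x y * tperm y z * tperm x y = tperm x z)%g.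
  by rewrite -{1}(tpermV x y) -mulgA -/(conjg _ _) tpermJ tpermR tpermD.
by rewrite -{1}(tpermV y z) -mulgA -/(conjg _ _) tpermJ tpermL tpermD // eq_sym.
Qed.
End PermAct.

(** * The pentagon and commutation relations *)

Section Psi.
Variable Phi : {linear tensor2 A -> tensor2 A}.
Hypothesis Phi_dual : dual_lCEDS Phi.

Definition psi (E : finType) (x y : E) : tpow A E -> tpow A E :=
  act2 (@flip K A \o Phi) x y.

Lemma psi_permT (E : finType) (s : {perm E}) x y t :
  psi (s x) (s y) (permT s t) = permT s (psi x y t).
Proof. exact: act2_permT. Qed.

(** All transpositions are moved to the left. In the first axiom they become the two sides of the
    braid relation and can be removed; in the second they cancel in pairs on each side. *)
Lemma psi_I3 : let: (x, y, z) := (inord 0, inord 1, inord 2) : 'I_3 * 'I_3 * 'I_3 in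
  (forall t, psi x y (psi x z (psi y z t)) = psi y z (psi x y t)) /\
  (forall t, psi y x (psi y z t) = psi y z (psi y x t)).
Proof.
set x : 'I_3 := inord 0; set y : 'I_3 := inord 1; set z : 'I_3 := inord 2.
have [xy yz xz] : [/\ x != y, y != z & x != z] by rewrite -!val_eqE /= !inordK.
have [yx zy zx] : [/\ y != x, z != y & z != x] by rewrite ![_ == x]eq_sym [z == y]eq_sym.
case: Phi_dual => H1 H2.
have E1 u v (t : tpow A 'I_3) : u != v -> act2 Phi u v t = permT (tperm u v) (psi u v t).
  by move=> uv; rewrite act2_flip_comp.
have S u v w1 w2 (t : tpow A 'I_3) : psi w1 w2 (permT (tperm u v) t) =
    permT (tperm u v) (psi (tperm u v w1) (tperm u v w2) t).
  by rewrite -psi_permT !tpermK.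
have T1 : (tperm x y x = y) * (tperm x y y = x) * (tperm x y z = z).
  by rewrite tpermL tpermR tpermD.
have T2 : (tperm y z x = x) * (tperm y z y = z) * (tperm y z z = y).
  by rewrite tpermL tpermR tpermD.
split=> t.
  have := H1 t; rewrite !E1 // act2_flip // !(S, T1, T2) !permT_comp.
  by rewrite mulgA -tperm_braid // -mulgA; apply: permT_inj.
by have := H2 t; rewrite !E1 // !act2_flip // !(S, T1, T2) !permTK.
Qed.

Lemma inj_tnth3 (E : eqType) (x y z : E) : x != y -> y != z -> x != z ->
  injective (tnth [tuple x; y; z]).
Proof.
move=> xy yz xz; apply/tuple_uniqP.
by rewrite /= !inE negb_or xy xz yz.
Qed.

Lemma psi_slice3 (E : finType) (f : 'I_3 -> E) b i j t : injective f ->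
  slice f b (psi (f i) (f j) t) = psi i j (slice f b t).
Proof. by move=> f_inj; apply: slice_act2. Qed.

Variable E : finType.
Implicit Types (x y z u v : E) (t : tpow A E).

(** Slicing along the injection of ['I_3] with values [x], [y], [z] reduces the relation to three
    factors. *)
Lemma psi_pentagon x y z t : x != y -> y != z -> x != z ->
  psi x y (psi x z (psi y z t)) = psi y z (psi x y t).
Proof.
move=> xy yz xz; have f_inj := inj_tnth3 xy yz xz; set f := tnth _ in f_inj.
have [xE yE zE] : [/\ f (inord 0) = x, f (inord 1) = y & f (inord 2) = z].
  by rewrite /f !(tnth_nth x) /= !inordK.
rewrite -xE -yE -zE; apply: (@slice_inj _ _ f) => b; rewrite !psi_slice3 //.
by have [H _] := psi_I3; apply: H.
Qed.

Lemma psi_comm_source x y z t : x != y -> x != z ->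
  psi x y (psi x z t) = psi x z (psi x y t).
Proof.
move=> xy xz; have [->//|yz] := eqVneq y z.
have yx : y != x by rewrite eq_sym.
(* The common source is the middle factor in the second axiom, whence the order [y], [x], [z]. *)
have f_inj := inj_tnth3 yx xz yz; set f := tnth _ in f_inj.
have [xE yE zE] : [/\ f (inord 0) = y, f (inord 1) = x & f (inord 2) = z].
  by rewrite /f !(tnth_nth x) /= !inordK.
rewrite -xE -yE -zE; apply: (@slice_inj _ _ f) => b; rewrite !psi_slice3 //.
by have [_ H] := psi_I3; apply: H.
Qed.

(** A structure constant of [psi]; the flip accounts for the exchanged indices [q p]. *)
Definition psi_coef (r : B * B) (p q : B) : K := (Phi (delta_mx r.1 r.2) : 'M__) q p.

Lemma psiE x y t b :
  psi x y t b = \sum_(r : B * B) t (upd2 b x y r.1 r.2) * psi_coef r (b x) (b y).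
Proof.
rewrite /psi act2E /= /flip mxE.
set M := \matrix_(i, j) _; rewrite [X in Phi X]matrix_sum_delta pair_bigA /=.
rewrite linear_sum summxE; apply: eq_bigr => r _.
by rewrite linearZ mxE mxE.
Qed.

Lemma psi_comm_disjoint x y u v t : x != u -> x != v -> y != u -> y != v ->
  psi x y (psi u v t) = psi u v (psi x y t).
Proof.
move=> xu xv yu yv; apply/ffunP => b; rewrite !psiE.
under eq_bigr => r _ do rewrite psiE mulr_suml.
under [RHS]eq_bigr => r _ do rewrite psiE mulr_suml.
rewrite exchange_big; apply: eq_bigr => r _; apply: eq_bigr => r' _ /=.
rewrite mulrAC !upd2_out //; try by rewrite eq_sym.
congr (t _ * _ * _); apply/ffunP => e; rewrite !ffunE.
case: (eqVneq e u) => [->|_]; first by rewrite eq_sym (negbTE xu) eq_sym (negbTE yu).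
by case: (eqVneq e v) => [->|_//]; rewrite eq_sym (negbTE xv) eq_sym (negbTE yv).
Qed.

Lemma psi_comm x y u v t : x != y -> u != v -> x != v -> u != y -> y != v ->
  psi x y (psi u v t) = psi u v (psi x y t).
Proof.
move=> xy uv xv uy yv; have [<-|xu] := eqVneq x u.
  by rewrite psi_comm_source.
by rewrite psi_comm_disjoint // eq_sym.
Qed.

End Psi.
End Tensors.

(** * Twists *)

Section Twists.
Variables (K : fieldType) (A : vectType K) (Phi : {linear tensor2 A -> tensor2 A}).
Hypothesis Phi_dual : dual_lCEDS Phi.
Variable E : finType.
Implicit Types (e f u v x : E) (p q s : seq E) (t : tpow A E) (P Q : E -> seq E).
Implicit Types I J L : {set E}.

(** Separates the twist from the forest: only the list [P e] attached to each edge matters. *)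
Definition twists P s t : tpow A E :=
  foldl (fun (w : tpow A E) e => twist_edge Phi e (P e) w) t s.

Lemma twist_edge_cons e x p t :
  twist_edge Phi e (x :: p) t = psi Phi x e (twist_edge Phi e p t).
Proof. by []. Qed.

Lemma twist_edge_rcons e x p t :
  twist_edge Phi e (rcons p x) t = twist_edge Phi e p (psi Phi x e t).
Proof. by rewrite /twist_edge foldr_rcons. Qed.

Lemma twist_edge_psi e p u v t : u != v -> e != v -> u != e ->
  {in p, forall x, x != e /\ x != v} ->
  twist_edge Phi e p (psi Phi u v t) = psi Phi u v (twist_edge Phi e p t).
Proof.
move=> uv ev ue; elim: p => // x p IH H; rewrite !twist_edge_cons IH => [|y yp].
  by have [xe xv] := H x (mem_head _ _); rewrite psi_comm.
by apply: H; rewrite inE yp orbT.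
Qed.

Lemma twist_edge_comm e f p q t : e != f ->
  {in p, forall x, x != e /\ x != f} -> {in q, forall x, x != e /\ x != f} ->
  twist_edge Phi e p (twist_edge Phi f q t) = twist_edge Phi f q (twist_edge Phi e p t).
Proof.
move=> ef Hp; elim: q => // x q IH Hq; rewrite !twist_edge_cons -IH => [|y yq].
  by have [xe xf] := Hq x (mem_head _ _); rewrite twist_edge_psi.
by apply: Hq; rewrite inE yq orbT.
Qed.

(** No edge of [s] belongs to a list [P e] with [e] in [s], so two edges of [s] never act on each
    other and their twists commute. *)
Lemma twists_perm P s s' t : {in s, forall e x, x \in P e -> x \notin s} ->
  perm_eq s s' -> twists P s t = twists P s' t.
Proof.
move=> Ps; apply: foldl_perm => e f es fs z; have [->//|ef] := eqVneq e f.
rewrite twist_edge_comm 1?eq_sym // => x /Ps xP; split;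
  by apply: contraNneq (xP _) => // ->.
Qed.

Lemma eq_twists P Q s t : {in s, P =1 Q} -> twists P s t = twists Q s t.
Proof.
rewrite /twists; elim: s t => //= e s IH t PQ; rewrite PQ ?mem_head // IH // => x xs.
by rewrite PQ // inE xs orbT.
Qed.

Lemma twists_cons P e s t : twists P (e :: s) t = twists P s (twist_edge Phi e (P e) t).
Proof. by []. Qed.

Lemma twists_cat P s s' t : twists P (s ++ s') t = twists P s' (twists P s t).
Proof. exact: foldl_cat. Qed.

Lemma twists_psi P s u v t : u != v -> u \notin s -> v \notin s ->
  {in s, forall e x, x \in P e -> x != e /\ x != v} ->
  twists P s (psi Phi u v t) = psi Phi u v (twists P s t).
Proof.
move=> uv; elim: s t => // e s IH t; rewrite !inE !negb_or => /andP[ue us] /andP[ve vs] H.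
rewrite !twists_cons twist_edge_psi ?IH // 1?eq_sym //.
  by move=> x xs; apply: H; rewrite inE xs orbT.
by move=> x; apply: H; rewrite mem_head.
Qed.

Lemma twists_twist_edge P s e p t : e \notin s -> {in p, forall x, x \notin s /\ x != e} ->
  {in s, forall f x, x \in P f -> x != f /\ x != e} ->
  twists P s (twist_edge Phi e p t) = twist_edge Phi e p (twists P s t).
Proof.
move=> es; elim: p => // x p IH Hp Hs; have [xs xe] := Hp x (mem_head _ _).
rewrite !twist_edge_cons twists_psi // IH // => y yp.
by apply: Hp; rewrite inE yp orbT.
Qed.

(** For a head [x] of the list, [psi x e] passes over the twist of [f] by the tail; the induction
    hypothesis then leaves one pentagon relation for [x], [f], [e]. *)
Lemma twist_edge_pentagon e f p t : f != e -> {in p, forall x, x != e /\ x != f} ->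
  twist_edge Phi f p (twist_edge Phi e p (psi Phi f e t)) =
  psi Phi f e (twist_edge Phi f p t).
Proof.
move=> fe; elim: p => // x p IH H; have [xe xf] := H x (mem_head _ _).
have {}H : {in p, forall x, x != e /\ x != f} by move=> y yp; apply: H; rewrite inE yp orbT.
rewrite !twist_edge_cons twist_edge_psi // => [|y /H[]//].
by rewrite IH // psi_pentagon.
Qed.

(* [P e] stands for the list of the edges above [e], and [J] and [J :|: L] for the
   nested sets of edges of an iterated coproduct; [s] lists the edges of [L] and
   [s'] those outside [J :|: L]. *)
Section Coassociativity.
Variables (P : E -> seq E) (J L : {set E}) (s s' : seq E).
Hypothesis JL : [disjoint J & L].
Hypothesis sL : {subset s <= L}.
Hypothesis us : uniq s.
Hypothesis us' : uniq s'.
Hypothesis s'JL : {in s', forall e, e \notin J :|: L}.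
Hypothesis P_prefix : {in s', forall e f q1 q2, P e = q1 ++ f :: q2 -> f \in L ->
  f \in s /\ P f = q1}.
Local Notation S := (twists (fun f => run J (P f)) s).

Let sJ e x : e \in s -> x \in run J (P e) -> x \notin s.
Proof.
by move=> es /run_in xJ; apply: contraTN xJ => /sL xL; rewrite (disjointFl JL).
Qed.

Let run_s' e x q : e \in s' -> x \in run J q -> x != e.
Proof. by move=> /s'JL + /run_in xJ; apply: contraNneq => <-; rewrite inE xJ. Qed.

(** Induction along the path to [e], starting from the root, [q1] being the part already treated.
    Keeping [P e = q1 ++ q2] lets [P_prefix] identify the path of each edge of [L] that is met. *)
Lemma twists_twist_edge_run e q1 q2 t : e \in s' -> P e = q1 ++ q2 ->
  S (twist_edge Phi e (run (J :|: L) q1) t) =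
  twist_edge Phi e [seq x <- run (J :|: L) q1 | x \notin J]
    (twist_edge Phi e (run J q1) (S t)).
Proof.
move=> es'; elim/last_ind: q1 q2 t => // q x IH q2 t PE.
have /norP[eJ eL] : ~~ ((e \in J) || (e \in L)) by have := s'JL es'; rewrite inE.
have es : e \notin s by apply: contra eL; apply: sL.
have {}PE : P e = q ++ x :: q2 by rewrite PE -cats1 -catA.
have {}IH t' := IH _ t' PE.
rewrite !run_rcons inE; have [xJ|xJ] /= := boolP (x \in J).
  (* An edge [x] of [J] only lengthens the run in [J], and [psi x e] commutes with [S]. *)
  have xs : x \notin s by apply: contraTN xJ => /sL xL; rewrite (disjointFl JL).
  rewrite filter_rcons xJ /= !twist_edge_rcons IH twists_psi //.
    by apply: contraNneq eJ => <-.
  move=> f fs y yf; split; last exact: run_s' yf.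
  by apply: contraNneq (sJ fs yf) => ->.
(* An edge outside [J :|: L] empties all the runs. An edge [x] of [L] empties the run in [J]: the
   twist of [e] by the previous run has to be absorbed by the pentagon relation. *)
case: ifP => [xL|//]; rewrite filter_rcons xJ !twist_edge_rcons IH.
have [xs xE] := P_prefix es' PE xL; congr twist_edge.
have xe : x != e by apply: contraNneq eL => <-.
have qxe y : y \in run J q -> y \notin s /\ y != e.
  by move=> yq; split; [apply: (sJ xs); rewrite xE|apply: run_s' yq].
have sP f : f \in s -> forall y, y \in run J (P f) -> y != f /\ y != e.
  move=> fs y yf; split; last exact: run_s' yf.
  by apply: contraNneq (sJ fs yf) => ->.
rewrite -twists_twist_edge //.
(* The order in [s] being free, the twist of [x] is performed first, where it meets the twist of [e]
   by the same list. *)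
have rs : perm_eq s (x :: rem x s) by rewrite perm_to_rem.
have sJ' : {in s, forall f y, y \in run J (P f) -> y \notin s} by move=> f fs y; apply: sJ.
rewrite !(twists_perm _ sJ' rs) !twists_cons xE twist_edge_pentagon //; last first.
  by move=> y /qxe[ys ye]; split=> //; apply: contraNneq ys => ->.
have urs : uniq (x :: rem x s) by rewrite -(perm_uniq rs).
rewrite twists_psi //; first by case/andP: urs.
  by apply: contra es; apply: mem_rem.
by move=> f /mem_rem; apply: sP.
Qed.

(** The edges of [s'] pass through [S] one at a time. The factor of the twist of [e] supported on
    [L] is then moved past the twists by [J] of the remaining edges. *)
Lemma twists_coassoc t : twists (fun f => run J (P f)) s
    (twists (fun e => run (J :|: L) (P e)) s' t) =
  twists (fun e => [seq x <- run (J :|: L) (P e) | x \notin J]) s'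
    (twists (fun e => run J (P e)) (s ++ s') t).
Proof.
rewrite twists_cat.
suff H r : uniq r -> {subset r <= s'} -> forall t,
    S (twists (fun e => run (J :|: L) (P e)) r t) =
    twists (fun e => [seq x <- run (J :|: L) (P e) | x \notin J]) r
      (twists (fun e => run J (P e)) r (S t)) by apply: H.
elim: r => // e r IH; rewrite cons_uniq => /andP[er ur] rs' {}t.
have es' : e \in s' by rewrite rs' // mem_head.
have {}rs' : {subset r <= s'} by move=> x xr; rewrite rs' // inE xr orbT.
rewrite !twists_cons {}IH // (@twists_twist_edge_run e _ [::]) ?cats0 //.
congr twists; rewrite twists_twist_edge //.
  move=> x; rewrite mem_filter => /andP[xJ /run_in]; rewrite inE (negbTE xJ) /= => xL.
  split; last by have := s'JL es'; rewrite inE => /norP[_]; apply: contraNneq => <-.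
  by apply/negP => /rs'/s'JL; rewrite inE xL orbT.
by move=> f fr x xP; split; apply: run_s' xP => //; apply: rs'.
Qed.

End Coassociativity.
End Twists.

(** * Tensors in coordinates *)

Section Coordinates.
Variables (K : fieldType) (A : vectType K) (Phi : {linear tensor2 A -> tensor2 A}).
Local Notation B := (bidx A).

Definition bas (E : finType) (b : {ffun E -> B}) : tpow A E := [ffun c => (c == b)%:R].

Lemma bas_sum (E : finType) (t : tpow A E) b : t b = \sum_c t c * bas c b.
Proof.
rewrite (bigD1 b) //= ffunE eqxx mulr1 big1 ?addr0 // => c /negbTE.
by rewrite ffunE eq_sym => ->; rewrite mulr0.
Qed.

(** * Linearity and locality of the twists *)

Section Local.
Variable E : finType.
Implicit Types (I : {set E}) (t : tpow A E) (b c : {ffun E -> B}) (W : tpow A E -> tpow A E).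

Definition coord_linear W := forall t b, W t b = \sum_c t c * W (bas c) b.

Lemma coord_linear_comp W W' :
  coord_linear W -> coord_linear W' -> coord_linear (W \o W').
Proof.
move=> HW HW' t b /=; rewrite HW.
transitivity (\sum_c \sum_d t d * W' (bas d) c * W (bas c) b).
  by apply: eq_bigr => c _; rewrite HW' mulr_suml.
rewrite exchange_big; apply: eq_bigr => c _ /=.
by rewrite [in RHS]HW mulr_sumr; apply: eq_bigr => d _; rewrite mulrA.
Qed.

Lemma psi_linear x y : coord_linear (@psi K A Phi E x y).
Proof.
move=> t b; rewrite psiE.
under [RHS]eq_bigr => c _ do rewrite psiE mulr_sumr.
rewrite exchange_big; apply: eq_bigr => r _ /=.
rewrite [t _]bas_sum mulr_suml; apply: eq_bigr => c _; by rewrite mulrA.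
Qed.

Lemma twist_edge_linear e p : coord_linear (@twist_edge K A E Phi e p).
Proof.
elim: p => [|x p IH]; first exact: bas_sum.
by move=> t b; apply: (coord_linear_comp (@psi_linear x e) IH).
Qed.

Lemma twists_linear P s : coord_linear (@twists K A Phi E P s).
Proof.
elim: s => [|e s IH]; first exact: bas_sum.
by move=> t b; apply: (coord_linear_comp IH (@twist_edge_linear e (P e))).
Qed.

(** A support condition preserved by the maps [psi] between factors in [I]; it expresses that the
    types of the other edges do not change. *)
Definition agrees_off (I : {set E}) c t :=
  forall b e, e \notin I -> b e != c e -> t b = 0.

Lemma psi_agrees I c x y t : x \in I -> y \in I -> agrees_off I c t ->
  agrees_off I c (psi Phi x y t).
Proof.
move=> xI yI tc b e eI be; rewrite psiE big1 // => r _.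
rewrite (tc _ e) ?mul0r // upd2_out //; by apply: contraNneq eI => ->.
Qed.

Lemma twist_edge_agrees I c e p t : e \in I -> {subset p <= I} -> agrees_off I c t ->
  agrees_off I c (twist_edge Phi e p t).
Proof.
move=> eI; elim: p => // x p IH pI tc; apply: psi_agrees => //; first by rewrite pI ?mem_head.
by apply: IH => // y yp; rewrite pI // inE yp orbT.
Qed.

Lemma twists_agrees I c P s t : {subset s <= I} -> {in s, forall e, {subset P e <= I}} ->
  agrees_off I c t -> agrees_off I c (twists Phi P s t).
Proof.
elim: s t => // e s IH t sI PI tc; rewrite twists_cons; apply: IH.
- by move=> x xs; rewrite sI // inE xs orbT.
- by move=> x xs; apply: PI; rewrite inE xs orbT.
- by apply: twist_edge_agrees => //; [rewrite sI ?mem_head | apply: PI; rewrite mem_head].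
Qed.

Lemma bas_agrees I c : agrees_off I c (bas c).
Proof. by move=> b e _ be; rewrite ffunE; case: eqP => // bc; rewrite bc eqxx in be. Qed.

End Local.

(** * Tensors along an injection of label sets *)

Section Push.
Variables (E E' : finType) (f : E -> E').
Hypothesis f_inj : injective f.
Implicit Types (t : tpow A E') (b : {ffun E' -> B}).

(* Each tensor factor outside the image of [f] is contracted with the sum of the
   coordinates. *)
Definition push t : tpow A E :=
  [ffun c => \sum_(b : {ffun E' -> B} | [ffun e => b (f e)] == c) t b].

Lemma push_psi x y t : x != y -> push (psi Phi (f x) (f y) t) = psi Phi x y (push t).
Proof.
move=> xy; have fxy : f x != f y by rewrite (inj_eq f_inj).
apply/ffunP => c; rewrite psiE ffunE.
under eq_bigr => b bc.
  have bE e : b (f e) = c e by rewrite -(eqP bc) ffunE.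
  rewrite psiE !bE; over.
rewrite exchange_big; apply: eq_bigr => r _ /=; rewrite -mulr_suml; congr (_ * _).
(* The indices over the updated [c] and those over [c] correspond by changing the values at [f x]
   and [f y]; the inverse restores [c x] and [c y]. *)
rewrite ffunE [RHS](reindex_onto (fun b => upd2 b (f x) (f y) r.1 r.2)
  (fun b => upd2 b (f x) (f y) (c x) (c y))) => [|b /eqP bE]; last first.
  apply/ffunP => e; rewrite !ffunE.
  have bF e0 : b (f e0) = upd2 c x y r.1 r.2 e0 by rewrite -bE ffunE.
  case: eqP => [->|_]; first by rewrite bF upd2l.
  by case: eqP => [->|//]; rewrite bF upd2r.
apply: eq_bigl => b; apply/eqP/andP => [bc|[/eqP/ffunP H1 /eqP/ffunP H2]].
  have bE e : b (f e) = c e by rewrite -bc ffunE.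
  split; apply/eqP/ffunP => e; rewrite !ffunE.
    by rewrite !(inj_eq f_inj) bE.
  case: eqP => [->|_]; first by rewrite bE.
  by case: eqP => [->|//]; rewrite bE.
apply/ffunP => e; rewrite ffunE; have := H1 e; have := H2 (f e).
rewrite !ffunE !(inj_eq f_inj).
case: (eqVneq e x) => [-> -> //|ex]; case: (eqVneq e y) => [-> -> //|ey].
by [].
Qed.

Lemma push_twist_edge e p t : e \notin p ->
  push (twist_edge Phi (f e) (map f p) t) = twist_edge Phi e p (push t).
Proof.
elim: p => // x p IH; rewrite inE negb_or => /andP[ex ep].
by rewrite map_cons !twist_edge_cons push_psi 1?eq_sym // IH.
Qed.

Lemma push_twists P P' s t : {in s, forall e, e \notin P e /\ P' (f e) = map f (P e)} ->
  push (twists Phi P' (map f s) t) = twists Phi P s (push t).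
Proof.
elim: s t => // e s IH t H; have [eP PE] := H e (mem_head _ _).
rewrite map_cons !twists_cons IH ?PE ?push_twist_edge // => x xs.
by apply: H; rewrite inE xs orbT.
Qed.

Lemma push_bas b : push (bas b) = bas [ffun e => b (f e)].
Proof.
apply/ffunP => c; rewrite !ffunE.
under eq_bigr => d _ do rewrite ffunE.
have [->|cb] := eqVneq c.
  rewrite (bigD1 b) //= eqxx big1 ?addr0 // => d /andP[_ /negbTE->//].
by rewrite big1 // => d /eqP dc; case: eqP => // db; rewrite -dc db eqxx in cb.
Qed.

Lemma push_sum (V : lmodType K) (X : {ffun E -> B} -> V) t :
  \sum_b t b *: X [ffun e => b (f e)] = \sum_c push t c *: X c.
Proof.
rewrite (partition_big (fun b : {ffun E' -> B} => [ffun e => b (f e)]) predT) //=.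
apply: eq_bigr => c _; rewrite ffunE scaler_suml.
by apply: eq_bigr => b /eqP->.
Qed.

End Push.

(** * External tensor products, over a disjoint union of label sets *)

Section Box.
Variables (E1 E2 : finType).
Local Notation E := (E1 + E2)%type.

Definition box (t1 : tpow A E1) (t2 : tpow A E2) : tpow A E :=
  [ffun b : {ffun E -> B} => t1 [ffun e => b (inl e)] * t2 [ffun e => b (inr e)]].

Lemma box_psil x y t1 t2 : psi Phi (inl x) (inl y) (box t1 t2) = box (psi Phi x y t1) t2.
Proof.
apply/ffunP => b; rewrite [RHS]ffunE !psiE mulr_suml; apply: eq_bigr => r _.
rewrite !ffunE mulrAC; congr (t1 _ * _ * t2 _).
  by apply/ffunP => e; rewrite !ffunE.
by apply/ffunP => e; rewrite !ffunE.
Qed.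

Lemma box_psir x y t1 t2 : psi Phi (inr x) (inr y) (box t1 t2) = box t1 (psi Phi x y t2).
Proof.
apply/ffunP => b; rewrite [RHS]ffunE !psiE mulr_sumr; apply: eq_bigr => r _.
rewrite !ffunE mulrA; congr (t1 _ * t2 _ * _).
  by apply/ffunP => e; rewrite !ffunE.
by apply/ffunP => e; rewrite !ffunE.
Qed.

Lemma box_twist_edgel e p t1 t2 : twist_edge Phi (inl e) (map inl p) (box t1 t2) =
  box (twist_edge Phi e p t1) t2.
Proof. by elim: p => // x p IH; rewrite map_cons !twist_edge_cons IH box_psil. Qed.

Lemma box_twist_edger e p t1 t2 : twist_edge Phi (inr e) (map inr p) (box t1 t2) =
  box t1 (twist_edge Phi e p t2).
Proof. by elim: p => // x p IH; rewrite map_cons !twist_edge_cons IH box_psir. Qed.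

Lemma box_twists P P1 P2 s1 s2 t1 t2 :
  (forall e, P (inl e) = map inl (P1 e)) -> (forall e, P (inr e) = map inr (P2 e)) ->
  twists Phi P (map inl s1 ++ map inr s2) (box t1 t2) =
  box (twists Phi P1 s1 t1) (twists Phi P2 s2 t2).
Proof.
move=> HP1 HP2; rewrite twists_cat.
have -> : twists Phi P (map inl s1) (box t1 t2) = box (twists Phi P1 s1 t1) t2.
  by elim: s1 t1 => // e s IH t1; rewrite map_cons !twists_cons HP1 box_twist_edgel IH.
by elim: s2 t2 => // e s IH t2; rewrite map_cons !twists_cons HP2 box_twist_edger IH.
Qed.

Lemma box_bas (b : {ffun E -> B}) :
  box (bas [ffun e => b (inl e)]) (bas [ffun e => b (inr e)]) = bas b.
Proof.
apply/ffunP => c; rewrite !ffunE -natrM mulnb; congr (nat_of_bool _)%:R.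
apply/andP/eqP => [[/eqP/ffunP H1 /eqP/ffunP H2]|->//].
by apply/ffunP => -[e|e]; [have := H1 e|have := H2 e]; rewrite !ffunE.
Qed.

Lemma box_sum (V : lmodType K) (X : {ffun E1 -> B} -> {ffun E2 -> B} -> V) t1 t2 :
  \sum_b box t1 t2 b *: X [ffun e => b (inl e)] [ffun e => b (inr e)] =
  \sum_b1 \sum_b2 (t1 b1 * t2 b2) *: X b1 b2.
Proof.
rewrite pair_bigA /=.
pose h (b : {ffun E1 -> B} * {ffun E2 -> B}) : {ffun E -> B} :=
  [ffun e => match e with inl e => b.1 e | inr e => b.2 e end].
have hl b : [ffun e => h b (inl e)] = b.1 by apply/ffunP => e; rewrite !ffunE.
have hr b : [ffun e => h b (inr e)] = b.2 by apply/ffunP => e; rewrite !ffunE.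
rewrite (reindex h) /=; last first.
  exists (fun b => ([ffun e => b (inl e)], [ffun e => b (inr e)])) => b _.
    by rewrite hl hr; case: b.
  by apply/ffunP => -[e|e]; rewrite !ffunE.
by apply: eq_bigr => b _; rewrite ffunE hl hr.
Qed.

End Box.
End Coordinates.

(** * Linear maps on monoid algebras *)

Section MonoidAlgebra.
Variable K : fieldType.

Lemma linextEw (M : choiceType) (V : lmodType K) (h : M -> V) u (d : {fset M}) :
  (msupp u `<=` d)%fset -> linext h u = \sum_(m <- d) u@_m *: h m.
Proof.
move=> ud; rewrite /linext (big_fset_incl _ ud) // => m _ /mcoeff_outdom->.
by rewrite scale0r.
Qed.

Lemma linext_is_linear (M : choiceType) (V : lmodType K) (h : M -> V) :
  linear (linext h).
Proof.
move=> k u v; set d := (msupp u `|` msupp v `|` msupp (k *: u + v))%fset.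
have [du dv dw] : [/\ (msupp u `<=` d)%fset, (msupp v `<=` d)%fset &
    (msupp (k *: u + v) `<=` d)%fset].
  by split; apply/fsubsetP => x xu; rewrite /d !in_fsetU xu ?orbT.
rewrite !(linextEw h (d := d)) // scaler_sumr -big_split; apply: eq_bigr => m _ /=.
by rewrite mcoeffD mcoeffZ scalerDl scalerA.
Qed.

HB.instance Definition _ (M : choiceType) (V : lmodType K) (h : M -> V) :=
  GRing.isLinear.Build K {malg K[M]} V _ (linext h) (linext_is_linear h).

Lemma linextU (M : choiceType) (V : lmodType K) (h : M -> V) m : linext h << m >> = h m.
Proof. by rewrite /linext msuppU oner_eq0 big_seq_fset1 mcoeffUU scale1r. Qed.

Lemma eq_linext (M : choiceType) (V : lmodType K) (h h' : M -> V) :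
  h =1 h' -> linext h =1 linext h'.
Proof. by move=> hh' u; apply: eq_bigr => m _; rewrite hh'. Qed.

Lemma malg_span (M : choiceType) (u : {malg K[M]}) :
  u = \sum_(m <- msupp u) u@_m *: << m >>.
Proof.
rewrite {1}[u]monalgE; apply: eq_bigr => m _; apply/malgP => k.
by rewrite mcoeffZ !mcoeffU mulr_natr.
Qed.

Lemma malg_ext (M : choiceType) (V : lmodType K) (f g : {linear {malg K[M]} -> V}) :
  (forall m, f << m >> = g << m >>) -> f =1 g.
Proof.
move=> fg u; rewrite [u]malg_span !linear_sum; apply: eq_bigr => m _.
by rewrite !linearZ fg.
Qed.

Lemma tensU (M N : monomType) (m : M) (v : {malg K[N]}) :
  tens << m >> v = linext (fun n => << (m, n) >>) v.
Proof. by rewrite /tens linextU. Qed.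

Lemma tensUr (M N : monomType) (u : {malg K[M]}) (n : N) :
  tens u << n >> = linext (fun m => << (m, n) >>) u.
Proof. by apply: eq_linext => m; rewrite linextU. Qed.

Lemma malgZU_mul (M : monomType) (c d : K) (m n : M) :
  (c *: << m >>) * (d *: << n >>) = (c * d) *: << mmul m n >> :> {malg K[M]}.
Proof.
have E (a : K) (k : M) : a *: << k >> = << a *g k >> :> {malg K[M]}.
  by apply/malgP => k'; rewrite mcoeffZ !mcoeffU mulr_natr.
by rewrite !E malgM_def fgmulUU.
Qed.

Lemma malgU_mul (M : monomType) (m n : M) :
  << m >> * << n >> = << mmul m n >> :> {malg K[M]}.
Proof. by rewrite malgM_def fgmulUU mulr1. Qed.

(* The library has this only for commutative monoids. *)
Lemma malg_scalerAr (M : monomType) (c : K) (u v : {malg K[M]}) :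
  u * (c *: v) = c *: (u * v).
Proof.
rewrite [u]malg_span [v]malg_span scaler_sumr !mulr_suml scaler_sumr.
apply: eq_bigr => m _; rewrite !mulr_sumr scaler_sumr; apply: eq_bigr => n _.
by rewrite scalerA !malgZU_mul scalerA mulrCA.
Qed.

End MonoidAlgebra.

(** * The coproduct *)

Section Coproduct.
Variables (K : fieldType) (A : vectType K) (D : semigroupType).
Variable Phi : {linear tensor2 A -> tensor2 A}.
Hypothesis mulC : commutative (fun x y : D => (x * y)%g).
Hypothesis Phi_dual : dual_lCEDS Phi.
Local Notation B := (bidx A).
Local Notation M := (forest_monom A D).

Definition mon (E : finType) (b : {ffun E -> B}) (F : seq (tree D E)) : M :=
  monomial (map (map_tree b) F).

Lemma monE (E : finType) (b : {ffun E -> B}) F F' :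
  monomial F = monomial F' -> mon b F = mon b F'.
Proof. by apply: monomial_map => t t'; apply: pi_map_tree. Qed.

Lemma mon_map (E E' : finType) (f : E -> E') (b : {ffun E' -> B}) F :
  mon b (map (map_tree f) F) = mon [ffun e => b (f e)] F.
Proof.
rewrite /mon -map_comp; congr monomial; apply: eq_map => t /=.
by rewrite map_tree_comp; apply: eq_map_tree_in => e _; rewrite ffunE.
Qed.

Definition edge_set (E : finType) (F : seq (tree D E)) : {set E} := [set e in edges F].

(** Only edges of [F] are treated, in the order of [edges F], whereas [twist] runs through [~: I].
    The two agree when [edges F] enumerates [E]. *)
Definition cut_twist (E : finType) (I : {set E}) (F : seq (tree D E)) : tpow A E -> tpow A E :=
  twists Phi (path_above I F) [seq e <- edges F | e \notin I].

Definition cop_term (E : finType) (F : seq (tree D E)) (t : tpow A E) I : Sg2 A D :=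
  forest2 (restrict I F) (contract I F) (cut_twist I F t).

(* The edges of [F] need not exhaust [E]: [cop] is also used for [restrict I F]
   and [contract I F]. *)
Definition cop (E : finType) (F : seq (tree D E)) (t : tpow A E) : Sg2 A D :=
  \sum_(I : {set E} | I \subset edge_set F) cop_term F t I.

Lemma forest2E (E : finType) (G H : seq (tree D E)) (t : tpow A E) : forest2 G H t =
  \sum_b t b *: (<< (mon b G, mon b H) >> : Sg2 A D).
Proof. by []. Qed.

Lemma forest2_linear (E : finType) (G H : seq (tree D E)) W (t : tpow A E) :
  coord_linear W -> forest2 G H (W t) = \sum_c t c *: forest2 G H (W (bas c)).
Proof.
move=> HW; rewrite forest2E.
transitivity (\sum_b \sum_c (t c * W (bas c) b) *: (<< (mon b G, mon b H) >> : Sg2 A D)).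
  by apply: eq_bigr => b _; rewrite HW scaler_suml.
rewrite exchange_big; apply: eq_bigr => c _; rewrite forest2E scaler_sumr.
by apply: eq_bigr => b _; rewrite scalerA.
Qed.

Lemma cut_twist_linear (E : finType) I (F : seq (tree D E)) : coord_linear (cut_twist I F).
Proof. exact: twists_linear. Qed.

Lemma cop_linear (E : finType) (F : seq (tree D E)) t :
  cop F t = \sum_c t c *: cop F (bas c).
Proof.
transitivity (\sum_(I : {set E} | I \subset edge_set F) \sum_c t c *: cop_term F (bas c) I).
  by apply: eq_bigr => I _; apply/forest2_linear/cut_twist_linear.
by rewrite exchange_big; apply: eq_bigr => c _; rewrite scaler_sumr.
Qed.

Lemma path_above_in (E : finType) (I : {set E}) (F : seq (tree D E)) e x :
  x \in path_above I F e -> x \in I.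
Proof. exact: run_in. Qed.

Lemma cut_twist_perm (E : finType) (I : {set E}) (F : seq (tree D E)) s t :
  perm_eq s [seq e <- edges F | e \notin I] ->
  cut_twist I F t = twists Phi (path_above I F) s t.
Proof.
rewrite perm_sym; apply: twists_perm => // e _ x /path_above_in xI.
by rewrite mem_filter xI.
Qed.

(** Isomorphic forests have the same labels and the same paths. Only the order in which the edges
    are treated differs, and [cut_twist_perm] absorbs it. *)
Lemma cop_iso (E : finType) (F F' : seq (tree D E)) t :
  monomial F = monomial F' -> uniq (edges F) -> cop F t = cop F' t.
Proof.
move=> FF' uF; have Fe := monomial_edges FF'.
have eF : edge_set F = edge_set F' by apply/setP => e; rewrite !inE (perm_mem Fe).
rewrite /cop eF; apply: eq_bigr => I _; rewrite /cop_term !forest2E; apply: eq_bigr => b _.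
rewrite (monE b (monomial_restrict I FF')) (monE b (monomial_contract mulC I FF')).
rewrite (@cut_twist_perm _ I F [seq e <- edges F' | e \notin I]).
  rewrite (@eq_twists _ _ _ _ _ (path_above I F')) // => e _.
  by rewrite !path_aboveE (monomial_above e FF').
by rewrite perm_sym perm_filter.
Qed.

Lemma cop_map (E E' : finType) (f : E -> E') (F : seq (tree D E)) t : injective f ->
  cop (map (map_tree f) F) t = cop F (push f t).
Proof.
move=> f_inj; rewrite /cop.
(* The sets in the left sum consist of edges of the relabelled forest, so they lie in the image of
   [f]. *)
rewrite (reindex_onto (fun I : {set E} => f @: I) (fun I' => f @^-1: I')) /=.
  have fI (I : {set E}) e : (f e \in f @: I) = (e \in I) by rewrite mem_imset.
  apply: eq_big => I.
    have -> : f @^-1: (f @: I) == I by apply/eqP/setP => e; rewrite inE fI.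
    rewrite andbT; apply/subsetP/subsetP => H e.
      by rewrite -fI => /H; rewrite !inE edges_map mem_map.
    by case/imsetP => e1 /H + ->; rewrite !inE edges_map mem_map.
  move=> _; rewrite /cop_term (restrict_map (fI I)) (contract_map (fI I)) !forest2E.
  have pE : push f (cut_twist (f @: I) (map (map_tree f) F) t) = cut_twist I F (push f t).
    rewrite [RHS]/cut_twist.
    rewrite -(@push_twists _ _ _ _ _ _ f_inj _ (path_above (f @: I) (map (map_tree f) F))).
      rewrite /cut_twist; congr (push f (twists _ _ _ _)).
      rewrite edges_map filter_map; congr map; apply: eq_filter => e /=.
      by rewrite fI.
    move=> e; rewrite mem_filter => /andP[eI _]; split.
      by apply: contra eI => /path_above_in.
    by rewrite !path_aboveE above_map // (run_map _ (fI I)).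
  rewrite -pE -(push_sum f (fun c => << (mon c (restrict I F), mon c (contract I F)) >>)).
  by apply: eq_bigr => b _; rewrite !mon_map.
move=> I' /subsetP H; apply/setP => e'; apply/imsetP/idP => [[e]|eI].
  by rewrite inE => ? ->.
have := H _ eI; rewrite inE edges_map => /mapP[e _ eE]; exists e => //.
by rewrite inE -eE.
Qed.

End Coproduct.

(** * Labelled representatives of monomials *)

Section Labelling.
Variable D : choiceType.

Lemma forest_labelling (X : finType) (G : seq (tree D X)) :
  exists F : seq (tree D 'I_(size (edges G))), exists b : {ffun _ -> X},
    edges F = enum 'I_(size (edges G)) /\ map (map_tree b) F = G.
Proof.
have [|F FG FE] := @forest_relabel D _ _ G (enum 'I_(size (edges G))).
  by rewrite size_enum_ord.
have [|b bF] := forest_map_edges FG; first by rewrite FE.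
by exists F, b.
Qed.

Lemma forest_exists (X : choiceType) (m : {cmonom (rtree D X)}) :
  exists F : seq (tree D X), monomial F == m.
Proof. by have [F <-] := monomial_surj m; exists F. Qed.

Definition forest_of (X : choiceType) (m : {cmonom (rtree D X)}) : seq (tree D X) :=
  xchoose (forest_exists m).

Lemma forest_ofK (X : choiceType) (m : {cmonom (rtree D X)}) : monomial (forest_of m) = m.
Proof. exact/eqP/(xchooseP (forest_exists m)). Qed.

End Labelling.

(** * Construction, formula and uniqueness of the coproduct *)

Section Delta.
Variables (K : fieldType) (A : vectType K) (D : semigroupType).
Variable Phi : {linear tensor2 A -> tensor2 A}.
Hypothesis mulC : commutative (fun x y : D => (x * y)%g).
Hypothesis Phi_dual : dual_lCEDS Phi.
Local Notation B := (bidx A).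
Local Notation M := (forest_monom A D).

(** The property of [F] is boolean, the typings being finite in number, so that [xchoose] can select
    a labelled forest. *)
Lemma mon_labelling (m : M) : exists F : seq (tree D 'I_(size (edges (forest_of m)))),
  (perm_eq (edges F) (enum 'I_(size (edges (forest_of m)))) &&
  [exists b : {ffun _ -> B}, mon b F == m]).
Proof.
have [F [b [FE bF]]] := forest_labelling (forest_of m).
by exists F; rewrite FE perm_refl; apply/existsP; exists b; rewrite /mon bF forest_ofK.
Qed.

Definition lab_forest (m : M) := xchoose (mon_labelling m).

Lemma lab_typing (m : M) : exists b : {ffun _ -> B}, mon b (lab_forest m) == m.
Proof. by apply/existsP; have /andP[] := xchooseP (mon_labelling m). Qed.

Definition lab_type (m : M) := xchoose (lab_typing m).

Lemma lab_forestP m :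
  perm_eq (edges (lab_forest m)) (enum 'I_(size (edges (forest_of m)))).
Proof. by have /andP[] := xchooseP (mon_labelling m). Qed.

Lemma lab_typeP m : mon (lab_type m) (lab_forest m) = m.
Proof. exact/eqP/(xchooseP (lab_typing m)). Qed.

Lemma mon_full (m : M) : exists n (F : seq (tree D 'I_n)) (b : {ffun 'I_n -> B}),
  perm_eq (edges F) (enum 'I_n) /\ mon b F = m.
Proof.
by exists _, (lab_forest m), (lab_type m); split; [apply: lab_forestP|apply: lab_typeP].
Qed.

(* Two labellings of the same monomial by [E] and [E'] are related, up to
   isomorphism, by an injection from [E] to [E']. *)
Lemma cop_mon (E E' : finType) (F : seq (tree D E)) (F' : seq (tree D E')) b b' :
    perm_eq (edges F) (enum E) -> uniq (edges F') -> mon b F = mon b' F' ->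
  cop Phi F (bas b) = cop Phi F' (bas b').
Proof.
move=> Fe uF' /monomial_map_lift[F1 FF1 F1F'].
have F1e : perm_eq (edges F1) (enum E).
  by apply: perm_trans Fe; rewrite perm_sym monomial_edges.
have [|f fF1] := @forest_map_edges _ _ _ F1 F' _ F1e.
  by have := congr1 (map (@shape_of D B)) F1F'; rewrite -!map_comp;
    do 2![rewrite (eq_map (g := @shape_of D _)) => [|t /=]; last by rewrite shape_of_map].
(* The map [f] sends [edges F1], which enumerates [E], to the repetition-free list [edges F']. *)
have f_inj : injective f.
  apply/injectiveP; rewrite /injectiveb /dinjectiveb -(perm_uniq (perm_map f F1e)).
  by rewrite -edges_map fF1.
have bE : b = [ffun e => b' (f e)].
  have : map b (edges F1) = map (b' \o f) (edges F1).
    by rewrite map_comp -!edges_map F1F' fF1.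
  by move/eq_in_map => H; apply/ffunP => e; rewrite ffunE H // (perm_mem F1e) mem_enum.
rewrite (cop_iso mulC Phi_dual _ FF1); last by rewrite (perm_uniq Fe) enum_uniq.
rewrite -fF1 cop_map; last exact: f_inj.
by rewrite push_bas -bE.
Qed.

Definition delta : Sg A D -> Sg2 A D :=
  linext (fun m : M => cop Phi (lab_forest m) (bas (lab_type m))).

HB.instance Definition _ := GRing.Linear.on delta.

Lemma delta_mon (E : finType) (F : seq (tree D E)) b : uniq (edges F) ->
  delta << mon b F >> = cop Phi F (bas b).
Proof.
move=> uF; rewrite /delta linextU; apply: cop_mon => //; first exact: lab_forestP.
exact: lab_typeP.
Qed.

Lemma delta_formula : coproduct_formula Phi delta.
Proof.
move=> E F Fe a; have uF : uniq (edges F) by rewrite (perm_uniq Fe) enum_uniq.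
have -> : forest F a = \sum_b pure a b *: (<< mon b F >> : Sg A D) by [].
rewrite linear_sum; transitivity (\sum_b pure a b *: cop Phi F (bas b)).
  by apply: eq_bigr => b _; rewrite linearZ /= delta_mon.
rewrite -cop_linear /cop; apply: eq_big => [I|I _].
  by apply/subsetP => e _; rewrite inE (perm_mem Fe) mem_enum.
rewrite /cop_term (cut_twist_perm _ (s := enum (~: I))) //.
rewrite perm_sym; apply: uniq_perm; rewrite ?enum_uniq ?filter_uniq // => e.
by rewrite mem_filter (perm_mem Fe) !mem_enum in_setC andbT.
Qed.

Lemma pure_bas (E : finType) (b : {ffun E -> B}) :
  pure (fun e => (vbasis {:A})`_(b e)) = bas b.
Proof.
apply/ffunP => c; rewrite !ffunE.
under eq_bigr => e _ do rewrite coord_free ?(basis_free (vbasisP _)) //.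
have [->|cb] := eqVneq c b; first by rewrite big1 // => e _; rewrite eqxx.
have [e ce] : exists e, c e != b e.
  apply/existsP; rewrite -negb_forall; apply: contra cb => /forallP H.
  by apply/eqP/ffunP => e; apply/eqP.
by rewrite (bigD1 e) //= eq_sym (negbTE ce) mul0r.
Qed.

Lemma forest_mon (E : finType) (F : seq (tree D E)) (b : {ffun E -> B}) :
  forest F (fun e => (vbasis {:A})`_(b e)) = << mon b F >>.
Proof.
rewrite /forest pure_bas (bigD1 b) //= ffunE eqxx scale1r big1 ?addr0 // => c cb.
by rewrite ffunE (negbTE cb) scale0r.
Qed.

(** Forests typed by vectors of the basis of [A] are exactly the monomials, so the formula
    prescribes the values on a basis. *)
Lemma delta_unique (delta' : {linear Sg A D -> Sg2 A D}) :
  coproduct_formula Phi delta' -> delta' =1 delta.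
Proof.
move=> H; apply: (malg_ext (M := M)) => m; have [n [F [b [Fe <-]]]] := mon_full m.
rewrite -forest_mon H //; exact/esym/delta_formula.
Qed.

End Delta.

(** * Multiplicativity *)

Section Multiplicativity.
Variables (K : fieldType) (A : vectType K) (D : semigroupType).
Variable Phi : {linear tensor2 A -> tensor2 A}.
Hypothesis mulC : commutative (fun x y : D => (x * y)%g).
Hypothesis Phi_dual : dual_lCEDS Phi.
Local Notation B := (bidx A).
Local Notation M := (forest_monom A D).

Section Disjoint.
Variables E1 E2 : finType.
Local Notation E := (E1 + E2)%type.

Definition disjoint_cat (F1 : seq (tree D E1)) (F2 : seq (tree D E2)) : seq (tree D E) :=
  map (map_tree inl) F1 ++ map (map_tree inr) F2.

Definition set_sum (I1 : {set E1}) (I2 : {set E2}) : {set E} :=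
  [set e | match e with inl e1 => e1 \in I1 | inr e2 => e2 \in I2 end].

Lemma set_sum_inl I1 I2 e : (inl e \in set_sum I1 I2) = (e \in I1).
Proof. by rewrite inE. Qed.

Lemma set_sum_inr I1 I2 e : (inr e \in set_sum I1 I2) = (e \in I2).
Proof. by rewrite inE. Qed.

Lemma mon_disjoint_cat (b : {ffun E -> B}) F1 F2 : mon b (disjoint_cat F1 F2) =
  mmul (mon [ffun e => b (inl e)] F1) (mon [ffun e => b (inr e)] F2).
Proof. by rewrite -!mon_map /mon /disjoint_cat map_cat monomial_cat. Qed.

Lemma edges_disjoint_cat F1 F2 :
  edges (disjoint_cat F1 F2) = map inl (edges F1) ++ map inr (edges F2).
Proof. by rewrite edges_cat !edges_map. Qed.

Lemma forest2_mul (G1 H1 : seq (tree D E1)) (G2 H2 : seq (tree D E2)) t1 t2 :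
  forest2 (disjoint_cat G1 G2) (disjoint_cat H1 H2) (box t1 t2) =
  forest2 G1 H1 t1 * forest2 G2 H2 t2 :> Sg2 A D.
Proof.
rewrite !forest2E.
transitivity (\sum_(b1 : {ffun E1 -> B}) \sum_(b2 : {ffun E2 -> B}) (t1 b1 * t2 b2) *:
    (<< (mmul (mon b1 G1) (mon b2 G2), mmul (mon b1 H1) (mon b2 H2)) >> : Sg2 A D)).
  rewrite -(box_sum (fun b1 b2 =>
    << (mmul (mon b1 G1) (mon b2 G2), mmul (mon b1 H1) (mon b2 H2)) >> : Sg2 A D)).
  by apply: eq_bigr => b _; rewrite !mon_disjoint_cat.
rewrite mulr_suml; apply: eq_bigr => b1 _; rewrite mulr_sumr; apply: eq_bigr => b2 _.
by rewrite malgZU_mul.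
Qed.

Lemma above_cat (E : finType) (F G : seq (tree D E)) e :
  above (F ++ G) e = above F e ++ above G e.
Proof. by rewrite /above map_cat flatten_cat. Qed.

Lemma above_disjoint_catl F1 F2 e :
  above (disjoint_cat F1 F2) (inl e) = map inl (above F1 e).
Proof.
rewrite above_cat above_map; last by move=> ? ? [].
rewrite [X in _ ++ X]above_notin ?cats0 // edges_map.
by apply/negP => /mapP[].
Qed.

Lemma above_disjoint_catr F1 F2 e :
  above (disjoint_cat F1 F2) (inr e) = map inr (above F2 e).
Proof.
rewrite above_cat [X in _ ++ X]above_map; last by move=> ? ? [].
rewrite [X in X ++ _]above_notin // edges_map.
by apply/negP => /mapP[].
Qed.

Lemma restrict_disjoint_cat F1 F2 I1 I2 :
  restrict (set_sum I1 I2) (disjoint_cat F1 F2) =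
  disjoint_cat (restrict I1 F1) (restrict I2 F2).
Proof.
rewrite /disjoint_cat restrict_cat (restrict_map (set_sum_inl I1 I2)).
by rewrite (restrict_map (set_sum_inr I1 I2)).
Qed.

Lemma contract_disjoint_cat F1 F2 I1 I2 :
  contract (set_sum I1 I2) (disjoint_cat F1 F2) =
  disjoint_cat (contract I1 F1) (contract I2 F2).
Proof.
rewrite /disjoint_cat -(contract_map (set_sum_inl I1 I2)).
by rewrite -(contract_map (set_sum_inr I1 I2)) -map_cat.
Qed.

(** No edge of one forest lies above an edge of the other, so the twist of an external product is
    the product of the two twists. *)
Lemma cop_term_mul F1 F2 I1 I2 t1 t2 :
  cop_term Phi (disjoint_cat F1 F2) (box t1 t2) (set_sum I1 I2) =
  cop_term Phi F1 t1 I1 * cop_term Phi F2 t2 I2.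
Proof.
rewrite /cop_term -forest2_mul restrict_disjoint_cat contract_disjoint_cat.
suff -> : cut_twist Phi (set_sum I1 I2) (disjoint_cat F1 F2) (box t1 t2) =
  box (cut_twist Phi I1 F1 t1) (cut_twist Phi I2 F2 t2) by [].
rewrite /cut_twist edges_disjoint_cat filter_cat !filter_map.
rewrite (eq_filter (a2 := fun e => e \notin I1)) => [|e /=]; last by rewrite inE.
rewrite [X in _ ++ map _ X](eq_filter (a2 := fun e => e \notin I2)) => [|e /=];
  last by rewrite inE.
apply: box_twists => e; rewrite !path_aboveE.
  by rewrite above_disjoint_catl (run_map _ (set_sum_inl I1 I2)).
by rewrite above_disjoint_catr (run_map _ (set_sum_inr I1 I2)).
Qed.

Lemma cop_mul F1 F2 t1 t2 :
  cop Phi (disjoint_cat F1 F2) (box t1 t2) = cop Phi F1 t1 * cop Phi F2 t2.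
Proof.
(* A set of edges of the disjoint union is a pair of sets of edges. *)
rewrite /cop (reindex (fun I : {set E1} * {set E2} => set_sum I.1 I.2)) /=; last first.
  exists (fun I : {set E} => (inl @^-1: I, inr @^-1: I)) => [[I1 I2] _|I _] /=.
    by congr (_, _); apply/setP => e; rewrite !inE.
  by apply/setP => -[e|e]; rewrite !inE.
rewrite mulr_suml; under [RHS]eq_bigr => I1 _ do rewrite mulr_sumr.
rewrite [RHS]pair_big /=; apply: eq_big => [[I1 I2]|[I1 I2] _] /=; last exact: cop_term_mul.
have inlE e : (inl e \in edge_set (disjoint_cat F1 F2)) = (e \in edge_set F1).
  rewrite !inE edges_disjoint_cat mem_cat mem_map; last by move=> ? ? [].
  by rewrite orbC; case: mapP => // -[].
have inrE e : (inr e \in edge_set (disjoint_cat F1 F2)) = (e \in edge_set F2).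
  rewrite !inE edges_disjoint_cat mem_cat [X in _ || X]mem_map; last by move=> ? ? [].
  by case: mapP => // -[].
apply/subsetP/andP => [H|[/subsetP H1 /subsetP H2] [e|e]].
- by split; apply/subsetP => e eI; rewrite -(inlE, inrE) H // inE.
- by rewrite set_sum_inl inlE; apply: H1.
- by rewrite set_sum_inr inrE; apply: H2.
Qed.

End Disjoint.

Local Notation delta := (delta (A := A) (D := D) Phi).

Lemma forest2_bas (E : finType) (G H : seq (tree D E)) (b : {ffun E -> B}) :
  forest2 G H (bas b) = << (mon b G, mon b H) >> :> Sg2 A D.
Proof.
rewrite forest2E (bigD1 b) //= ffunE eqxx scale1r big1 ?addr0 // => c cb.
by rewrite ffunE (negbTE cb) scale0r.
Qed.

Lemma delta1 : delta 1 = 1.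
Proof.
pose b : {ffun 'I_0 -> B} := ffun0 (card_ord 0).
have E : mon b ([::] : seq (tree D _)) = mone by rewrite /mon /= monomial_nil.
have -> : 1 = << mon b ([::] : seq (tree D 'I_0)) >> :> Sg A D by rewrite E.
rewrite delta_mon // /cop (big_pred1 set0) => [|I].
  by rewrite /cop_term forest2_bas E.
rewrite /= -subset0; suff -> : edge_set ([::] : seq (tree D 'I_0)) = set0 by [].
by apply/setP => e; rewrite !inE.
Qed.

Lemma delta_monM (m1 m2 : M) : delta (<< m1 >> * << m2 >>) = delta << m1 >> * delta << m2 >>.
Proof.
have [n1 [F1 [b1 [F1e <-]]]] := mon_full m1; have [n2 [F2 [b2 [F2e <-]]]] := mon_full m2.
(* The product monomial is labelled by the disjoint union of the two sets of labels. *)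
pose b : {ffun 'I_n1 + 'I_n2 -> B} :=
  [ffun e => match e with inl e => b1 e | inr e => b2 e end].
have bl : [ffun e => b (inl e)] = b1 by apply/ffunP => e; rewrite !ffunE.
have br : [ffun e => b (inr e)] = b2 by apply/ffunP => e; rewrite !ffunE.
have u1 : uniq (edges F1) by rewrite (perm_uniq F1e) enum_uniq.
have u2 : uniq (edges F2) by rewrite (perm_uniq F2e) enum_uniq.
rewrite malgU_mul; have -> : mmul (mon b1 F1) (mon b2 F2) = mon b (disjoint_cat F1 F2).
  by rewrite mon_disjoint_cat bl br.
have u : uniq (edges (disjoint_cat F1 F2)).
  rewrite edges_disjoint_cat cat_uniq !map_inj_uniq ?u1 ?u2; try by move=> ? ? [].
  by rewrite andbT; apply/hasPn => _ /mapP[e _ ->]; apply/mapP => -[].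
rewrite [LHS](delta_mon mulC Phi_dual b u).
rewrite [X in X * _](delta_mon mulC Phi_dual b1 u1).
rewrite [X in _ * X](delta_mon mulC Phi_dual b2 u2).
by rewrite -cop_mul -box_bas bl br.
Qed.

Lemma delta_mul u v : delta (u * v) = delta u * delta v.
Proof.
have scale_mul (N : monomType) (c d : K) (x y : {malg K[N]}) :
    (c *: x) * (d *: y) = (c * d) *: (x * y).
  by rewrite -scalerAl malg_scalerAr scalerA.
rewrite [u]malg_span [v]malg_span [X in delta X = _]mulr_suml [LHS]linear_sum.
rewrite [X in _ = X * _]linear_sum [X in _ = _ * X]linear_sum [RHS]mulr_suml.
apply: eq_bigr => m _; rewrite [X in delta X = _]mulr_sumr [RHS]mulr_sumr.
rewrite [LHS]linear_sum; apply: eq_bigr => n _; rewrite scale_mul [LHS]linearZ /=.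
rewrite [X in _ = X * _]linearZ [X in _ = _ * X]linearZ /=.
by rewrite scale_mul delta_monM.
Qed.

End Multiplicativity.

(** * Coassociativity *)

Section TensLinear.
Variable K : fieldType.

Lemma linear_comb (U V : lmodType K) (f : {linear U -> V}) (I : finType) (P : pred I)
    (k : I -> K) (x : I -> U) :
  f (\sum_(i | P i) k i *: x i) = \sum_(i | P i) k i *: f (x i).
Proof. by rewrite linear_sum; apply: eq_bigr => i _; rewrite linearZ. Qed.

HB.instance Definition _ (M N M' N' : monomType) (f : {malg K[M]} -> {malg K[M']})
  (g : {malg K[N]} -> {malg K[N']}) := GRing.Linear.on (tens_map f g).
HB.instance Definition _ (M : monomType) := GRing.Linear.on (@tens_assoc K M).
Lemma tens_assocU (M : monomType) (u : {malg K[prod M M]}) (q : M) :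
  tens_assoc (tens u << q >>) = linext (fun p : M * M => << (p.1, (p.2, q)) >>) u.
Proof.
rewrite tensUr; move: u.
apply: (malg_ext (f := @tens_assoc K M \o linext _) (g := linext _)) => m.
by rewrite /= !linextU /tens_assoc linextU.
Qed.

End TensLinear.

Section Coassociativity.
Variables (K : fieldType) (A : vectType K) (D : semigroupType).
Variable Phi : {linear tensor2 A -> tensor2 A}.
Hypothesis mulC : commutative (fun x y : D => (x * y)%g).
Hypothesis Phi_dual : dual_lCEDS Phi.
Local Notation B := (bidx A).
Local Notation M := (forest_monom A D).
Local Notation delta := (delta (A := A) (D := D) Phi).

Section Collapse.
Variable E : finType.
Implicit Types (F G H : seq (tree D E)) (t : tpow A E) (I J L : {set E}).

(** In [X b c] the index [b] types the tensor factor that is not cut again and [c] the two others.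
    The second twist does not change the types of the uncut factor, so both indices may be taken
    equal. *)
Lemma sum_collapse (V : lmodType K) (W : tpow A E -> tpow A E)
    (X : {ffun E -> B} -> {ffun E -> B} -> V) t :
  coord_linear W -> (forall b c, W (bas b) c != 0 -> X b c = X c c) ->
  \sum_b t b *: (\sum_c W (bas b) c *: X b c) = \sum_c W t c *: X c c.
Proof.
move=> HW HX.
transitivity (\sum_b \sum_c (t b * W (bas b) c) *: X c c).
  apply: eq_bigr => b _; rewrite scaler_sumr; apply: eq_bigr => c _.
  by have [->|/HX->] := eqVneq (W (bas b) c) 0; rewrite ?mulr0 ?scale0r ?scaler0 // scalerA.
rewrite exchange_big; apply: eq_bigr => c _.
by rewrite -scaler_suml -HW.
Qed.

Lemma eq_mon_in (b c : {ffun E -> B}) F : {in edges F, b =1 c} -> mon b F = mon c F.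
Proof.
move=> bc; congr monomial; apply/eq_in_map => t tF; apply: eq_map_tree_in => e et.
by apply: bc; apply/flatten_mapP; exists t.
Qed.

Lemma cut_twist_bas_off J G b c e : J \subset edge_set G -> e \notin edges G ->
  cut_twist Phi J G (bas b) c != 0 -> b e = c e.
Proof.
move=> JG eG; apply: contraNeq => bce; apply/eqP.
have eG' : e \notin edge_set G by rewrite inE.
suff H : agrees_off (edge_set G) b (cut_twist Phi J G (bas b)).
  by apply: H eG' _; rewrite eq_sym.
apply: twists_agrees; last exact: bas_agrees.
- by move=> x; rewrite mem_filter inE => /andP[].
- by move=> x _ y /path_above_in /(subsetP JG).
Qed.

Definition forest3 F G H t : {malg K[prod M (prod M M)]} :=
  \sum_b t b *: << (mon b F, (mon b G, mon b H)) >>.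

(** The twist inside [G] leaves the edges of [H] alone, so the types of [H] can be read after it and
    the sum over them collapses. *)
Lemma tens_delta_left G H t : uniq (edges G) ->
  {in edges H, forall e, e \notin edges G} ->
  tens_assoc (tens_map delta id (forest2 G H t)) =
  \sum_(J : {set E} | J \subset edge_set G)
    forest3 (restrict J G) (contract J G) H (cut_twist Phi J G t).
Proof.
move=> uG GH; rewrite forest2E.
rewrite [LHS](linear_comb (@tens_assoc K M \o tens_map delta id)).
transitivity (\sum_b \sum_(J : {set E} | J \subset edge_set G) t b *:
  (\sum_c cut_twist Phi J G (bas b) c *:
     (<< (mon c (restrict J G), (mon c (contract J G), mon b H)) >>
        : {malg K[prod M (prod M M)]}))).
  apply: eq_bigr => b _; rewrite -scaler_sumr; congr (_ *: _) => /=.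
  rewrite [X in tens_assoc X]linextU /= tens_assocU (delta_mon mulC Phi_dual b uG) /cop.
  rewrite [LHS]linear_sum; apply: eq_bigr => J _.
  rewrite /cop_term forest2E [LHS]linear_comb.
  by apply: eq_bigr => c _; rewrite /= linextU.
rewrite exchange_big; apply: eq_bigr => J JG.
apply: (sum_collapse (W := cut_twist Phi J G) (X := fun b c =>
  << (mon c (restrict J G), (mon c (contract J G), mon b H)) >>)) => [|b c Wbc].
  exact: cut_twist_linear.
by rewrite (@eq_mon_in b c) // => e /GH eG; apply: cut_twist_bas_off Wbc.
Qed.

Lemma tens_delta_right G H t : uniq (edges H) ->
  {in edges G, forall e, e \notin edges H} ->
  tens_map id delta (forest2 G H t) =
  \sum_(J : {set E} | J \subset edge_set H)
    forest3 G (restrict J H) (contract J H) (cut_twist Phi J H t).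
Proof.
move=> uH GH; rewrite forest2E [LHS](linear_comb (tens_map id delta)).
transitivity (\sum_b \sum_(J : {set E} | J \subset edge_set H) t b *:
  (\sum_c cut_twist Phi J H (bas b) c *:
     (<< (mon b G, (mon c (restrict J H), mon c (contract J H))) >>
        : {malg K[prod M (prod M M)]}))).
  apply: eq_bigr => b _; rewrite -scaler_sumr; congr (_ *: _) => /=.
  rewrite [LHS]linextU /= tensU (delta_mon mulC Phi_dual b uH) /cop.
  rewrite [LHS]linear_sum; apply: eq_bigr => J _.
  rewrite /cop_term forest2E [LHS]linear_comb.
  by apply: eq_bigr => c _; rewrite /= linextU.
rewrite exchange_big; apply: eq_bigr => J JG.
apply: (sum_collapse (W := cut_twist Phi J H) (X := fun b c =>
  << (mon b G, (mon c (restrict J H), mon c (contract J H))) >>)) => [|b c Wbc].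
  exact: cut_twist_linear.
by rewrite (@eq_mon_in b c) // => e /GH eG; apply: cut_twist_bas_off Wbc.
Qed.

(** All paths are expressed in [F]: those of the deleted forest by [above_restrict] and [run_run],
    those of the contracted one by [above_contract] and [run_filter]. The identity of twists then
    applies. *)
Lemma cut_twist_coassoc F J L t : uniq (edges F) -> [disjoint J & L] ->
  cut_twist Phi J (restrict (J :|: L) F) (cut_twist Phi (J :|: L) F t) =
  cut_twist Phi L (contract J F) (cut_twist Phi J F t).
Proof.
move=> uF JL; set s := [seq e <- edges F | e \in L].
set s' := [seq e <- edges F | e \notin J :|: L].
have JI : J \subset J :|: L by apply: subsetUl.
have LJ e : e \in L -> (e \in J) = false by move=> eL; rewrite (disjointFl JL eL).
have -> u : cut_twist Phi J (restrict (J :|: L) F) u =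
    twists Phi (fun e => run J (above F e)) s u.
  rewrite (cut_twist_perm Phi_dual _ (s := s)).
    apply: eq_twists => e; rewrite mem_filter path_aboveE => /andP[eL eF].
    by rewrite above_restrict // ?inE ?eL ?orbT // run_run.
  rewrite perm_sym (permPl (perm_filter _ (edges_restrict _ _))) -filter_predI.
  rewrite (eq_filter (a2 := fun e => e \in L)) // => e /=; rewrite inE.
  by case eL: (e \in L); [rewrite LJ|rewrite orbF andNb].
have -> u : cut_twist Phi L (contract J F) u =
    twists Phi (fun e => [seq x <- run (J :|: L) (above F e) | x \notin J]) s' u.
  rewrite /cut_twist edges_contract -filter_predI.
  rewrite (eq_filter (a2 := fun e => e \notin J :|: L)) => [|e /=]; last first.
    by rewrite inE negb_or andbC.
  apply: eq_twists => e; rewrite mem_filter inE negb_or path_aboveE => /andP[/andP[eJ eL] eF].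
  by rewrite above_contract // run_filter.
(* The edges outside [J] are treated starting with those in [L]. *)
rewrite [X in _ = twists _ _ _ X](cut_twist_perm Phi_dual _ (s := s ++ s')).
  apply: (twists_coassoc Phi_dual) => //.
  - by move=> e; rewrite mem_filter => /andP[].
  - by rewrite filter_uniq.
  - by rewrite filter_uniq.
  - by move=> e; rewrite mem_filter => /andP[].
  (* An edge of [L] above [e] has for path the corresponding prefix of the path to [e]. *)
  move=> e _ f q1 q2 /(above_prefix uF)[fF fE] fL; split=> //.
  by rewrite mem_filter fL.
apply: uniq_perm; rewrite ?filter_uniq //.
  rewrite cat_uniq !filter_uniq // andbT; apply/hasPn => e.
  by rewrite !mem_filter inE negb_or => /andP[/andP[_ /negbTE->]].
move=> e; rewrite mem_cat !mem_filter inE negb_or.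
case eL: (e \in L) => /=; first by rewrite LJ // andbF orbF.
by rewrite andbT.
Qed.

Lemma subset_edge_set_full F J : perm_eq (edges F) (enum E) -> J \subset edge_set F.
Proof. by move=> Fe; apply/subsetP => e _; rewrite inE (perm_mem Fe) mem_enum. Qed.

Lemma edge_set_restrict F I : perm_eq (edges F) (enum E) -> edge_set (restrict I F) = I.
Proof.
move=> Fe; apply/setP => e; rewrite inE (perm_mem (edges_restrict I F)) mem_filter.
by rewrite (perm_mem Fe) mem_enum andbT.
Qed.

Lemma edge_set_contract F I : perm_eq (edges F) (enum E) -> edge_set (contract I F) = ~: I.
Proof.
move=> Fe; apply/setP => e; rewrite !inE edges_contract mem_filter.
by rewrite (perm_mem Fe) mem_enum andbT.
Qed.

Lemma cop_coassoc F t : perm_eq (edges F) (enum E) ->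
  tens_assoc (tens_map delta id (cop Phi F t)) = tens_map id delta (cop Phi F t).
Proof.
move=> Fe; have uF : uniq (edges F) by rewrite (perm_uniq Fe) enum_uniq.
have urF I : uniq (edges (restrict I F)).
  by rewrite (perm_uniq (edges_restrict I F)) filter_uniq.
have ucF I : uniq (edges (contract I F)) by rewrite edges_contract filter_uniq.
have rc I e : e \in edges (contract I F) -> e \notin edges (restrict I F).
  rewrite edges_contract (perm_mem (edges_restrict I F)) !mem_filter.
  by case/andP => /negbTE->.
have cr I e : e \in edges (restrict I F) -> e \notin edges (contract I F).
  by apply: contraL => /rc.
have full J : J \subset edge_set F by apply: subset_edge_set_full.
rewrite [LHS](linear_sum (@tens_assoc K M \o tens_map delta id)).
rewrite [RHS](linear_sum (tens_map id delta)) /=.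
under eq_bigr => I _ do rewrite (tens_delta_left _ (urF I) (rc I)) edge_set_restrict //.
under [RHS]eq_bigr => J _ do
  rewrite (tens_delta_right _ (ucF J) (cr J)) edge_set_contract //.
(* The left side is a sum over [J] contained in [I], the right side over [J] and [L] contained in
   its complement; they are matched by [I = J :|: L]. *)
rewrite [LHS](exchange_big_dep predT); last by [].
apply: eq_big => [J|J _]; first by rewrite full.
rewrite [LHS](reindex_onto (fun L => J :|: L) (fun I => I :\: J)); last first.
  by move=> I /andP[_ JI]; rewrite setDE setUIr setUCr setIT; apply/setUidPr.
apply: eq_big => L.
  rewrite full subsetUl setDUl setDv set0U /=.
  by rewrite -disjoints_subset; apply/eqP/setDidPl.
case/andP => _ /eqP JL; have dJL : [disjoint J & L].
  by rewrite -JL disjoint_sym disjoints_subset setDE subsetIr.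
rewrite (cut_twist_coassoc t uF dJL) (contract_restrict F dJL) (contract_contract mulC F dJL).
(* The first forests agree only up to the order of their trees, which the monomial forgets. *)
apply: eq_bigr => b _.
by rewrite (monE b (monomial_perm (restrict_restrict F (subsetUl J L)))).
Qed.

End Collapse.
End Coassociativity.

(** * Counit *)

Section Counit.
Variables (K : fieldType) (A : vectType K) (D : semigroupType).
Variable Phi : {linear tensor2 A -> tensor2 A}.
Hypothesis mulC : commutative (fun x y : D => (x * y)%g).
Hypothesis Phi_dual : dual_lCEDS Phi.
Local Notation B := (bidx A).
Local Notation M := (forest_monom A D).
Local Notation delta := (delta (A := A) (D := D) Phi).

(** The choice of a representative is harmless, since isomorphic forests have equally many edges. *)
Definition counit : {malg K[M]} -> K^o :=
  linext (fun m : M => (edges (forest_of m) == [::])%:R : K^o).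

HB.instance Definition _ := GRing.Linear.on counit.

Lemma counit_monomial (F : seq (tree D B)) :
  counit << (monomial F : M) >> = (edges F == [::])%:R.
Proof.
rewrite /counit linextU -!size_eq0.
by rewrite (perm_size (monomial_edges (forest_ofK (monomial F)))).
Qed.

Lemma counit_mon (E : finType) (F : seq (tree D E)) (b : {ffun E -> B}) :
  counit << mon b F >> = (edges F == [::])%:R.
Proof. by rewrite counit_monomial -!size_eq0 edges_map size_map. Qed.

Lemma counit1 : counit 1 = 1.
Proof.
have -> : 1 = << (monomial ([::] : seq (tree D B)) : M) >> :> Sg A D by rewrite monomial_nil.
by rewrite counit_monomial.
Qed.

Lemma counit_mul u v : counit (u * v) = counit u * counit v.
Proof.
rewrite [u]malg_span [v]malg_span [X in counit X = _]mulr_suml.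
rewrite [LHS]linear_sum [X in _ = X * _]linear_sum [X in _ = _ * X]linear_sum.
rewrite [RHS]mulr_suml; apply: eq_bigr => m _.
rewrite [X in counit X = _]mulr_sumr [RHS]mulr_sumr [LHS]linear_sum.
apply: eq_bigr => n _; rewrite malgZU_mul [LHS]linearZ.
rewrite [X in _ = X * _]linearZ [X in _ = _ * X]linearZ /=.
rewrite -(forest_ofK m) -(forest_ofK n).
set F := forest_of m; set G := forest_of n.
have -> : mmul (monomial F) (monomial G) = monomial (F ++ G) by rewrite monomial_cat.
rewrite [X in _ *: X = _]counit_monomial [X in _ = (_ *: X) * _]counit_monomial.
rewrite [X in _ = _ * (_ *: X)]counit_monomial.
rewrite edges_cat -!size_eq0 size_cat addn_eq0 -mulnb natrM.
by rewrite /GRing.scale /= mulrACA.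
Qed.

Lemma cut_twist0 (E : finType) (F : seq (tree D E)) t : cut_twist Phi set0 F t = t.
Proof.
have run0 q : run (set0 : {set E}) q = [::].
  by elim/last_ind: q => // q x _; rewrite run_rcons inE.
rewrite /cut_twist; elim: [seq _ <- _ | _] => // e s IH.
by rewrite twists_cons path_aboveE run0.
Qed.

Lemma cut_twist_full (E : finType) (F : seq (tree D E)) t : cut_twist Phi setT F t = t.
Proof.
rewrite /cut_twist (eq_filter (a2 := pred0)) => [|e]; last by rewrite /= inE.
by rewrite filter_pred0.
Qed.

Section Terms.
Variables (E : finType) (F : seq (tree D E)) (b : {ffun E -> B}).
Hypothesis Fe : perm_eq (edges F) (enum E).

(** Each counit identity selects a single summand of the coproduct: [set0] on the left, where
    nothing is kept below, and [setT] on the right, where everything is contracted. *)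
Lemma cop_counit (f : {linear Sg2 A D -> Sg A D}) I0 :
  (forall I, I != I0 -> forall c,
     f << (mon c (restrict I F), mon c (contract I F)) >> = 0) ->
  f (cop_term Phi F (bas b) I0) = << mon b F >> ->
  f (cop Phi F (bas b)) = << mon b F >>.
Proof.
move=> fI fI0; rewrite [LHS]linear_sum (bigD1 I0) /=; last exact: subset_edge_set_full.
rewrite [X in _ + X]big1 => [|I /andP[_ II0]]; first by rewrite addr0.
rewrite /cop_term forest2E [LHS]linear_comb big1 // => c _.
by rewrite fI // scaler0.
Qed.

Lemma cop_counit_left :
  linext (fun p : M * M => counit << p.1 >> *: (<< p.2 >> : Sg A D)) (cop Phi F (bas b)) =
  << mon b F >>.
Proof.
apply: (cop_counit (f := linext _) (I0 := set0)) => [I I0 c|].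
  rewrite [LHS]linextU /= [X in X *: _]counit_mon; case: eqP; last by rewrite scale0r.
  (* A nonzero counit means that [restrict I F] has no edge, and its edges form the set [I]. *)
  move=> E0; case/negP: I0; rewrite -(edge_set_restrict I Fe) /edge_set E0.
  by apply/eqP/setP => e; rewrite !inE.
rewrite /cop_term cut_twist0 forest2_bas [LHS]linextU /= [X in X *: _]counit_mon contract0.
have -> : edges (restrict set0 F) == [::].
  rewrite -size_eq0 (perm_size (edges_restrict _ _)) size_eq0 -(negbK (_ == _)) -has_filter.
  by apply/negP => /hasP[e _]; rewrite inE.
by rewrite scale1r.
Qed.

Lemma cop_counit_right :
  linext (fun p : M * M => counit << p.2 >> *: (<< p.1 >> : Sg A D)) (cop Phi F (bas b)) =
  << mon b F >>.
Proof.
apply: (cop_counit (f := linext _) (I0 := setT)) => [I I0 c|].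
  rewrite [LHS]linextU /= [X in X *: _]counit_mon; case: eqP; last by rewrite scale0r.
  (* Here the edges of [contract I F] form the complement of [I]. *)
  move=> E0; case/negP: I0; rewrite -[I]setCK -(edge_set_contract I Fe) /edge_set E0.
  by apply/eqP/setP => e; rewrite !inE.
rewrite /cop_term cut_twist_full forest2_bas [LHS]linextU /= [X in X *: _]counit_mon.
rewrite restrict_full.
have -> : edges (contract setT F) == [::].
  rewrite edges_contract -(negbK (_ == _)) -has_filter.
  by apply/negP => /hasP[e _]; rewrite inE.
by rewrite scale1r.
Qed.

End Terms.

Lemma delta_bialgebra : bialgebra delta.
Proof.
split; first by split; [exact: delta1|exact: delta_mul].
  apply: (malg_ext (f := @tens_assoc K M \o (tens_map delta id \o delta))
                   (g := tens_map id delta \o delta)) => m.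
  have [n [F [b [Fe <-]]]] := mon_full m.
  have uF : uniq (edges F) by rewrite (perm_uniq Fe) enum_uniq.
  rewrite /= (delta_mon mulC Phi_dual b uF); exact: cop_coassoc.
exists counit; split; first by split; [exact: counit1|exact: counit_mul].
  apply: (malg_ext (f := linext _ \o delta) (g := idfun)) => m.
  have [n [F [b [Fe <-]]]] := mon_full m.
  have uF : uniq (edges F) by rewrite (perm_uniq Fe) enum_uniq.
  rewrite /= (delta_mon mulC Phi_dual b uF); exact: cop_counit_left.
apply: (malg_ext (f := linext _ \o delta) (g := idfun)) => m.
have [n [F [b [Fe <-]]]] := mon_full m.
have uF : uniq (edges F) by rewrite (perm_uniq Fe) enum_uniq.
rewrite /= (delta_mon mulC Phi_dual b uF); exact: cop_counit_right.
Qed.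

End Counit.

Theorem theorem4p2 (K : fieldType) (charK : [pchar K] =i pred0)
    (D : semigroupType) (mulC : commutative (fun x y : D => (x * y)%g))
    (A : vectType K) (Phi : {linear tensor2 A -> tensor2 A})
    (Phi_dual : dual_lCEDS Phi) :
  exists delta : {linear Sg A D -> Sg2 A D},
    [/\ coproduct_formula Phi delta,
        forall delta' : {linear Sg A D -> Sg2 A D},
          coproduct_formula Phi delta' -> delta' =1 delta
      & bialgebra delta].
Proof.
exists (delta (A := A) (D := D) Phi); split.
- exact: delta_formula.
- exact: delta_unique.
- exact: delta_bialgebra.
Qed.
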